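(* Let $p$ be a prime, $d\ge 1$ a natural number, and $\sigma,b$ positive real numbers. Let $\vec X$ be the max-norm process in $\mathbb{Q}_p^d$ with diffusion constant $\sigma$ and diffusion exponent $b$, with law $P^d$, and let $\alpha_d=1-\dfrac{p^b-1}{p^{b+d}-1}$. For any integer $R$ and any real $T>0$, $$P^d\left(\sup_{0\le t\le T}\|\vec X_t\|\le p^R\right)=e^{-\sigma\,\alpha_d\,T\,p^{-Rb}} .$$
   Context: $|\cdot|$ is the $p$-adic absolute value on $\mathbb{Q}_p$, $\|\vec x\|=\max_{1\le i\le d}|x_i|$ is the max-norm on $\mathbb{Q}_p^d$, and $\mu_d$ is the Haar measure on $\mathbb{Q}_p^d$ normalized by $\mu_d(\mathbb{Z}_p^d)=1$. $\chi(x)=e^{2\pi\sqrt{-1}\{x\}}$ is the standard additive character of $\mathbb{Q}_p$, with $\{x\}$ the $p$-adic fractional part. For $t>0$ put $\rho_d(t,\vec x)=\int_{\mathbb{Q}_p^d}\chi(\vec x\cdot\vec y)\,e^{-\sigma t\|\vec y\|^b}\,d\mu_d(\vec y)$, a probability density on $\mathbb{Q}_p^d$. $P^d$ is the probability measure on the Skorohod space $D([0,\infty):\mathbb{Q}_p^d)$ of càdlàg paths, concentrated on paths starting at $\vec 0$, under which increments over disjoint time intervals are independent and $\omega(t)-\omega(s)$, $0\le s<t$, has density $\rho_d(t-s,\cdot)$. The max-norm process is $\vec X_t(\omega)=\omega(t)$ under $P^d$. *)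

(* Defs.v *)
From HB Require Import structures.
From mathcomp Require Import all_boot all_order all_algebra.
From mathcomp Require Import all_classical all_reals all_analysis.
From mathcomp Require Import complex.

Set Implicit Arguments.
Unset Strict Implicit.
Unset Printing Implicit Defensive.

Import Order.TTheory GRing.Theory Num.Theory.
Import numFieldNormedType.Exports.

Local Open Scope classical_set_scope.
Local Open Scope ring_scope.
Local Open Scope quotient_scope.
Local Open Scope complex_scope.

Section RatPadicAbs.
Variable p : nat.

(* |p ^ k * (m / n)|_p = p ^ (- k) for m and n prime to p, and |0|_p = 0. *)
Definition ratabs (q : rat) : rat :=
  if q == 0 then 0
  else p%:R ^+ logn p `|denq q|%N / p%:R ^+ logn p `|numq q|%N.

Hypothesis p_pr : prime p.

Let p_gt0 : 0 < p%:R :> rat. Proof. by rewrite ltr0n prime_gt0. Qed.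
Let p_neq0 : p%:R != 0 :> rat. Proof. by rewrite gt_eqF. Qed.
Let pX_neq0 n : p%:R ^+ n != 0 :> rat. Proof. by rewrite expf_neq0. Qed.

Lemma ratabs_ge0 q : 0 <= ratabs q.
Proof. by rewrite /ratabs; case: ifP => // _; rewrite divr_ge0// exprn_ge0// ltW. Qed.

Lemma ratabs0 : ratabs 0 = 0.
Proof. by rewrite /ratabs eqxx. Qed.

Lemma ratabs_eq0 q : (ratabs q == 0) = (q == 0).
Proof.
rewrite /ratabs; have [_|q0] := eqVneq q 0; first by rewrite eqxx.
by rewrite mulf_eq0 invr_eq0 !(negbTE (pX_neq0 _)).
Qed.

Lemma ratabsN q : ratabs (- q) = ratabs q.
Proof. by rewrite /ratabs oppr_eq0 denqN numqN abszN. Qed.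

Lemma ratabs1 : ratabs 1 = 1.
Proof. by rewrite /ratabs oner_eq0 /= logn1 divrr// unitfE. Qed.

Lemma ratabs_frac (a b : int) : a != 0 -> b != 0 ->
  ratabs (a%:~R / b%:~R) = p%:R ^+ logn p `|b|%N / p%:R ^+ logn p `|a|%N.
Proof.
move=> a0 b0; set q := a%:~R / b%:~R.
have q0 : q != 0 by rewrite mulf_neq0 ?invr_eq0 ?intr_eq0.
rewrite /ratabs (negbTE q0).
have := divq_num_den q; rewrite /q => /eqP; rewrite -/q.
rewrite eqr_div ?intr_eq0 ?denq_neq0// -!intrM eqr_int => /eqP.
move=> /(congr1 absz); rewrite !abszM => /(congr1 (logn p)).
rewrite !lognM ?absz_gt0 ?numq_eq0 ?denq_neq0// => e.
by apply/eqP; rewrite eqr_div// -!exprD addnC -e addnC.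
Qed.

Lemma ratabsM : {morph ratabs : x y / x * y}.
Proof.
move=> x y.
have [->|x0] := eqVneq x 0; first by rewrite mul0r ratabs0 mul0r.
have [->|y0] := eqVneq y 0; first by rewrite mulr0 ratabs0 mulr0.
rewrite -{1}(divq_num_den x) -{1}(divq_num_den y).
rewrite mulf_div -!intrM ratabs_frac ?mulf_neq0 ?numq_eq0 ?denq_neq0//.
rewrite !abszM !lognM ?absz_gt0 ?numq_eq0 ?denq_neq0// !exprD -mulf_div.
by rewrite /ratabs (negbTE x0) (negbTE y0).
Qed.

Lemma ratabsD1 q : ratabs q <= 1 -> ratabs (1 + q) <= 1.
Proof.
have [->|q0] := eqVneq q 0; first by rewrite addr0 ratabs1.
have [->|s0] := eqVneq (1 + q) 0; first by rewrite ratabs0.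
rewrite {1}/ratabs (negbTE q0) ler_pdivrMr ?exprn_gt0// mul1r.
rewrite ler_eXn2l ?ltr1n ?prime_gt1// => le_dn.
have d0 : logn p `|denq q| = 0%N.
  apply/eqP; rewrite lognE p_pr absz_gt0 denq_neq0 /=.
  case: ifP => // pd; have := le_dn; rewrite lognE p_pr absz_gt0 denq_neq0 pd /=.
  case e : (logn p `|numq q|) => [//|k] _.
  have pn : (p %| `|numq q|)%N.
    apply: dvdn_trans (pfactor_dvdnn p _).
    by rewrite e expnS dvdn_mulr.
  have := coprime_num_den q => /eqP g1.
  have : (p %| 1)%N by rewrite -g1 dvdn_gcd pn pd.
  by rewrite dvdn1 => /eqP p1; move: p_pr; rewrite p1.
have e : 1 + q = (denq q + numq q)%:~R / (denq q)%:~R.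
  by rewrite intrD mulrDl divq_num_den divrr// unitfE intr_eq0 denq_neq0.
have n0 : denq q + numq q != 0.
  by apply: contraNneq s0 => n0; rewrite e n0 mul0r.
rewrite e ratabs_frac ?denq_neq0// d0 expr0 div1r invf_le1 ?exprn_gt0//.
by rewrite exprn_ege1// ler1n prime_gt0.
Qed.

Lemma ratabs_max x y : ratabs (x + y) <= Num.max (ratabs x) (ratabs y).
Proof.
wlog xy : x y / ratabs y <= ratabs x.
  move=> H; have /orP[|] := le_total (ratabs y) (ratabs x); first exact: H.
  by rewrite addrC maxC; exact: H.
rewrite max_l//; have [x0|x0] := eqVneq x 0.
  by move: xy; rewrite x0 ratabs0 add0r.
have ax : 0 < ratabs x by rewrite lt_neqAle eq_sym ratabs_eq0 x0 ratabs_ge0.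
have -> : x + y = x * (1 + y / x) by rewrite mulrDr mulr1 mulrCA divff// mulr1.
rewrite ratabsM -[leRHS]mulr1 ler_pM2l// ratabsD1//.
have : ratabs (y / x) * ratabs x <= 1 * ratabs x.
  by rewrite -ratabsM mulfVK// mul1r.
by rewrite ler_pM2r.
Qed.

Lemma ratabsB_lt x y e : ratabs x < e -> ratabs y < e -> ratabs (x - y) < e.
Proof.
move=> xe ye; apply: le_lt_trans (ratabs_max _ _) _.
by rewrite gt_max ratabsN xe.
Qed.

Lemma ratabsD_lt x y e : ratabs x < e -> ratabs y < e -> ratabs (x + y) < e.
Proof. by move=> xe ye; rewrite -[y]opprK ratabsB_lt// ratabsN. Qed.

Lemma ratabs_eq x y : ratabs (x - y) < ratabs y -> ratabs x = ratabs y.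
Proof.
move=> xy; apply/eqP; rewrite eq_le; apply/andP; split.
  by rewrite -[x](subrK y) (le_trans (ratabs_max _ _))// ge_max lexx ltW.
rewrite leNgt; apply/negP => lt_xy.
have : ratabs y < ratabs y.
  rewrite -{1}[y](subKr x) ratabsB_lt//.
by rewrite ltxx.
Qed.

End RatPadicAbs.

Section PadicField.
Variables (p : nat) (p_pr : prime p).

(* The primality proof is an argument so that the closure instances below can
   be attached to the predicate itself. *)
Definition padic_cauchy (_ : prime p) : {pred nat -> rat} := fun u =>
  `[< forall e : rat, 0 < e -> exists N, forall m n, (N <= m)%N -> (N <= n)%N ->
      ratabs p (u m - u n) < e >].

Local Notation cauchy := (padic_cauchy p_pr).

Lemma padic_cauchy_bounded u : u \in cauchy ->
  exists2 M : rat, 0 < M & forall n, ratabs p (u n) < M.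
Proof.
move=> /asboolP/(_ 1 ltr01)[N uN].
pose M := \sum_(i < N.+1) ratabs p (u i) + 1.
have M1 i : (i < N.+1)%N -> ratabs p (u i) < M.
  move=> iN; rewrite /M (bigD1 (Ordinal iN))//= -addrA ltrDl.
  by rewrite ltr_wpDl// sumr_ge0// => j _; exact: ratabs_ge0.
have M0 : 0 < M by exact: le_lt_trans (ratabs_ge0 _ _) (M1 0%N isT).
exists M => // n; have [nN|Nn] := ltnP n N; first by rewrite M1// ltnW.
rewrite -(subrK (u N) (u n)) ratabsD_lt ?M1//.
rewrite (lt_le_trans (uN _ _ Nn (leqnn N)))// lerDr sumr_ge0// => j _.
exact: ratabs_ge0.
Qed.

Lemma padic_cauchy_subring : GRing.subring_closed cauchy.
Proof.
split=> [|u v /asboolP uC /asboolP vC|u v uC vC].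
- by apply/asboolP => e e0; exists 0%N => m n _ _; rewrite subrr ratabs0.
- apply/asboolP => e e0; have [N uN] := uC e e0; have [N' vN] := vC e e0.
  exists (maxn N N') => m n; rewrite !geq_max => /andP[? ?] /andP[? ?].
  have -> : (u - v) m - (u - v) n = (u m - u n) - (v m - v n).
    by rewrite /= !opprD addrACA.
  by rewrite ratabsB_lt// ?uN// vN.
- have [M M0 uM] := padic_cauchy_bounded uC.
  have [M' M'0 vM] := padic_cauchy_bounded vC.
  move: uC vC => /asboolP uC /asboolP vC; apply/asboolP => e e0.
  have [N uN] := uC (e / M') (divr_gt0 e0 M'0).
  have [N' vN] := vC (e / M) (divr_gt0 e0 M0).
  exists (maxn N N') => m n; rewrite !geq_max => /andP[? ?] /andP[? ?].
  have -> : (u * v) m - (u * v) n = u m * (v m - v n) + (u m - u n) * v n.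
    by rewrite mulrBr mulrBl addrA subrK.
  rewrite ratabsD_lt// ratabsM//.
  + rewrite -[e](mulfVK (lt0r_neq0 M0)) mulrC.
    by rewrite ltr_pM ?ratabs_ge0// vN.
  + rewrite -[e](mulfVK (lt0r_neq0 M'0)).
    by rewrite ltr_pM ?ratabs_ge0// uN.
Qed.

HB.instance Definition _ :=
  GRing.isSubringClosed.Build (nat -> rat) cauchy padic_cauchy_subring.

Record padic_seq := PadicSeq {
  padic_seq_val :> nat -> rat; _ : padic_seq_val \in cauchy }.

HB.instance Definition _ := [isSub for padic_seq_val].
HB.instance Definition _ := [Choice of padic_seq by <:].
HB.instance Definition _ := [SubChoice_isSubComNzRing of padic_seq by <:].

Definition padic_null : {pred padic_seq} := fun u =>
  `[< forall e : rat, 0 < e -> exists N, forall n, (N <= n)%N ->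
      ratabs p (u n) < e >].

Lemma padic_null_ideal : idealr_closed padic_null.
Proof.
split.
- by apply/asboolP => e e0; exists 0%N => n _; rewrite ratabs0.
- apply/negP => /asboolP/(_ 1 ltr01)[N] /(_ N (leqnn N)).
  by rewrite ratabs1 ltxx.
- move=> a u v /asboolP u0 /asboolP v0; apply/asboolP => e e0.
  have [M M0 aM] := padic_cauchy_bounded (valP a).
  have [N uN] := u0 (e / M) (divr_gt0 e0 M0); have [N' vN] := v0 e e0.
  exists (maxn N N') => n; rewrite geq_max => /andP[? ?].
  rewrite ratabsD_lt ?vN// ratabsM//.
  rewrite -[e](mulfVK (lt0r_neq0 M0)) mulrC.
  by rewrite ltr_pM ?ratabs_ge0// uN.
Qed.

HB.instance Definition _ := isIdealr.Build padic_seq padic_null padic_null_ideal.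

(* Q_p is the completion of Q for |.|_p: Cauchy sequences modulo null ones. *)
Definition padic : Type := {ideal_quot padic_null}.

HB.instance Definition _ := GRing.ComNzRing.on padic.

Definition padic_pi (u : padic_seq) : padic := \pi_{ideal_quot padic_null} u.

HB.instance Definition _ :=
  GRing.RMorphism.copy padic_pi (\pi_{ideal_quot padic_null}).

Definition padic_repr (x : padic) : padic_seq :=
  repr (x : {ideal_quot padic_null}).

Lemma padic_reprK x : padic_pi (padic_repr x) = x.
Proof. exact: reprK. Qed.

Lemma padic_pi_eq0 u : (padic_pi u == 0) = (u \in padic_null).
Proof.
rewrite -[u in RHS]subr0 Quotient.idealrBE.
by rewrite -[0 in LHS](rmorph0 padic_pi).
Qed.

(* Along a Cauchy sequence that is not null, |u n|_p is eventually constant. *)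
Lemma padic_stationary u : u \notin padic_null ->
  exists2 r : rat, 0 < r & exists N, forall n, (N <= n)%N -> ratabs p (u n) = r.
Proof.
move=> /asboolPn/existsNP[e /not_implyP[e0 /forallNP ue]].
have /asboolP/(_ e e0)[N uN] := valP u.
have /existsNP[k /not_implyP[Nk /negP]] := ue N; rewrite -leNgt => ek.
exists (ratabs p (u k)); first exact: lt_le_trans ek.
exists N => n Nn; apply: (ratabs_eq p_pr).
exact: lt_le_trans (uN _ _ Nn Nk) ek.
Qed.

Lemma padic_mulV_ex (x : padic) : x != 0 -> exists y, y * x = 1.
Proof.
rewrite -{1}[x]padic_reprK padic_pi_eq0; set u := padic_repr x => u0.
have [r r0 [N uN]] := padic_stationary u0.
have un0 n : (N <= n)%N -> u n != 0.
  by move=> Nn; rewrite -(ratabs_eq0 p_pr) uN// gt_eqF.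
pose v n : rat := if (n < N)%N then 0 else (u n)^-1.
have vC : v \in padic_cauchy p_pr.
  have /asboolP uC := valP u; apply/asboolP => e e0.
  have [N' uN'] := uC (e * (r * r)) (mulr_gt0 e0 (mulr_gt0 r0 r0)).
  exists (maxn N N') => m n; rewrite !geq_max => /andP[Nm N'm] /andP[Nn N'n].
  rewrite /v !ltnNge Nm Nn /= -(ltr_pM2r (mulr_gt0 r0 r0)).
  rewrite -{1}(uN m Nm) -{1}(uN n Nn) -!(ratabsM p_pr).
  by rewrite mulrBl mulKf ?un0// [u m * _]mulrC mulKf ?un0// uN'.
exists (padic_pi (PadicSeq vC)); rewrite -[x]padic_reprK -/u -rmorphM.
apply/eqP; rewrite -subr_eq0 -(rmorph1 padic_pi) -rmorphB padic_pi_eq0.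
apply/asboolP => e e0; exists N => n Nn.
rewrite [X in ratabs p X](_ : _ = v n * u n - 1)//.
by rewrite /v ltnNge Nn /= mulVf ?un0// subrr ratabs0.
Qed.

Definition padic_inv (x : padic) : padic :=
  if x == 0 then 0 else xget 0 [set y | y * x = 1].

Lemma padic_mulVf x : x != 0 -> padic_inv x * x = 1.
Proof.
by move=> x0; rewrite /padic_inv (negbTE x0); have /xgetPex := padic_mulV_ex x0.
Qed.

Lemma padic_inv0 : padic_inv 0 = 0. Proof. by rewrite /padic_inv eqxx. Qed.

HB.instance Definition _ :=
  GRing.ComNzRing_isField.Build padic padic_mulVf padic_inv0.

(* |x|_p is the limit of |u n|_p along a Cauchy sequence u representing x; it is
   attained, so rational. *)
Definition padic_abs (x : padic) : rat :=
  xget 0 [set r : rat | forall e : rat, 0 < e ->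
    exists N, forall n, (N <= n)%N -> `|ratabs p (padic_repr x n) - r| < e].

Lemma padic_abs_repr x r :
  (forall e : rat, 0 < e ->
    exists N, forall n, (N <= n)%N -> `|ratabs p (padic_repr x n) - r| < e) ->
  padic_abs x = r.
Proof.
move=> rP; apply: xget_unique => // s sP; apply/eqP; rewrite -subr_eq0 -normr_eq0.
apply/eqP/le_anti; rewrite normr_ge0 andbT leNgt; apply/negP => sr0.
have [N rN] := rP _ (divr_gt0 sr0 (ltr0Sn rat 1)); have [N' sN] := sP _ (divr_gt0 sr0 (ltr0Sn rat 1)).
have {}rN := rN (maxn N N') (leq_maxl _ _).
have {}sN := sN (maxn N N') (leq_maxr _ _).
have := ltrD rN sN; rewrite -splitr addrC [X in X + _ < _]distrC.
move=> /(le_lt_trans (ler_normD _ _)); rewrite addrA subrK.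
by rewrite ltxx.
Qed.

Lemma padic_abs0 : padic_abs 0 = 0.
Proof.
apply: padic_abs_repr => e e0.
have : padic_repr 0 \in padic_null by rewrite -padic_pi_eq0 padic_reprK.
move=> /asboolP/(_ e e0)[N uN]; exists N => n Nn.
by rewrite subr0 ger0_norm ?ratabs_ge0// uN.
Qed.

(* The absolute value does not depend on the representative. *)
Lemma padic_absE (u : padic_seq) : padic_pi u != 0 ->
  exists N, forall n, (N <= n)%N -> ratabs p (u n) = padic_abs (padic_pi u).
Proof.
move=> u0; set x := padic_pi u.
have x0 : padic_repr x \notin padic_null by rewrite -padic_pi_eq0 padic_reprK.
have [r r0 [N rN]] := padic_stationary x0.
have -> : padic_abs x = r.
  by apply: padic_abs_repr => e e0; exists N => n Nn; rewrite rN// subrr normr0.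
have : u - padic_repr x \in padic_null.
  by rewrite -padic_pi_eq0 rmorphB /= padic_reprK subrr.
move=> /asboolP/(_ r r0)[N' uN]; exists (maxn N N') => n.
rewrite geq_max => /andP[Nn N'n].
by rewrite (ratabs_eq p_pr (y := padic_repr x n)) rN// uN.
Qed.

Lemma padic_abs_ge0 x : 0 <= padic_abs x.
Proof.
have [->|x0] := eqVneq x 0; first by rewrite padic_abs0.
rewrite -(padic_reprK x) in x0 *; have [N uN] := padic_absE x0.
by rewrite -(uN N)// ratabs_ge0.
Qed.

Lemma padic_abs_eq0 x : (padic_abs x == 0) = (x == 0).
Proof.
have [->|x0] := eqVneq x 0; first by rewrite padic_abs0 eqxx.
apply/negP => /eqP xa0; have y0 := x0; rewrite -(padic_reprK x) in y0.
have [N uN] := padic_absE y0; move/negP: y0; apply; rewrite padic_pi_eq0.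
apply/asboolP => e e0; exists N => n Nn.
by rewrite uN// padic_reprK xa0.
Qed.

Lemma padic_absN x : padic_abs (- x) = padic_abs x.
Proof.
have [->|x0] := eqVneq x 0; first by rewrite oppr0.
have := x0; rewrite -oppr_eq0 -(padic_reprK x) -rmorphN => y0.
have [N uN] := padic_absE y0; rewrite rmorphN oppr_eq0 in y0.
have [N' vN] := padic_absE y0.
by rewrite -(uN (maxn N N')) ?leq_maxl// -(vN (maxn N N')) ?leq_maxr// ratabsN.
Qed.

Lemma padic_absM : {morph padic_abs : x y / x * y}.
Proof.
move=> x y.
have [->|] := eqVneq x 0; first by rewrite mul0r padic_abs0 mul0r.
have [->|] := eqVneq y 0; first by rewrite mulr0 padic_abs0 mulr0.
rewrite -(padic_reprK x) -(padic_reprK y); set u := padic_repr x.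
set v := padic_repr y => v0 u0; have uv0 := mulf_neq0 u0 v0.
rewrite -rmorphM in uv0 *.
have [N uN] := padic_absE u0; have [N' vN] := padic_absE v0.
have [M uvN] := padic_absE uv0; pose n := maxn M (maxn N N').
have Nn : (N <= n)%N by rewrite !leq_max leqnn !orbT.
have N'n : (N' <= n)%N by rewrite !leq_max leqnn !orbT.
by rewrite -(uvN n) ?leq_maxl// -(uN n)// -(vN n)// -(ratabsM p_pr).
Qed.

Lemma padic_abs_max x y : padic_abs (x + y) <= Num.max (padic_abs x) (padic_abs y).
Proof.
have [->|] := eqVneq (x + y) 0; first by rewrite padic_abs0 le_max padic_abs_ge0.
have [->|] := eqVneq x 0; first by rewrite add0r le_max lexx orbT.
have [->|] := eqVneq y 0; first by rewrite addr0 le_max lexx.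
rewrite -(padic_reprK x) -(padic_reprK y); set u := padic_repr x.
set v := padic_repr y => v0 u0 uv0; rewrite -rmorphD in uv0 *.
have [N uN] := padic_absE u0; have [N' vN] := padic_absE v0.
have [M uvN] := padic_absE uv0; pose n := maxn M (maxn N N').
have Nn : (N <= n)%N by rewrite !leq_max leqnn !orbT.
have N'n : (N' <= n)%N by rewrite !leq_max leqnn !orbT.
by rewrite -(uvN n) ?leq_maxl// -(uN n)// -(vN n)// (ratabs_max p_pr).
Qed.

Definition padic_dist (x y : padic) : rat := padic_abs (x - y).

Lemma padic_distxx x : padic_dist x x = 0.
Proof. by rewrite /padic_dist subrr padic_abs0. Qed.

Lemma padic_dist_eq0 x y : padic_dist x y = 0 -> x = y.
Proof. by move=> /eqP; rewrite padic_abs_eq0 subr_eq0 => /eqP. Qed.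

Lemma padic_dist_sym x y : padic_dist x y = padic_dist y x.
Proof. by rewrite /padic_dist -padic_absN opprB. Qed.

Lemma padic_dist_triangle y x z :
  padic_dist x z <= padic_dist x y + padic_dist y z.
Proof.
rewrite /padic_dist -[x - z](subrKA y) (le_trans (padic_abs_max _ _))//.
by rewrite ge_max lerDl lerDr !padic_abs_ge0.
Qed.

HB.instance Definition _ := isMetric.Build rat padic
  padic_distxx padic_dist_eq0 padic_dist_sym padic_dist_triangle.
HB.instance Definition _ := isPointed.Build padic 0.

End PadicField.

Section PadicVectors.
Variables (R : realType) (p : nat) (p_pr : prime p) (d : nat).

Local Notation Qp := (padic p_pr).
Local Notation Qpd := 'rV[padic p_pr]_d.

Definition maxnorm (x : Qpd) : R :=
  \big[Num.max/0]_(i < d) ratr (padic_abs (x ord0 i)).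

Definition dotv (x y : Qpd) : Qp := \sum_(i < d) x ord0 i * y ord0 i.

(* Q_p^d with the Borel sigma-algebra of its product topology. *)
Definition padic_vec := g_sigma_algebraType (@open Qpd).

HB.instance Definition _ := Measurable.on padic_vec.

(* No regularity is required: it is automatic, Q_p^d being locally compact and
   second countable. Finiteness on compact sets follows from translation
   invariance, Z_p^d being open of finite measure. *)
Definition normalized_haar (mu : {measure set padic_vec -> \bar R}) : Prop :=
  (forall (x : Qpd) (A : set padic_vec), measurable A ->
    mu [set x + y | y in (A : set Qpd)] = mu A) /\
  mu [set x : Qpd | forall i, padic_abs (x ord0 i) <= 1] = 1%E.

(* The unique m / p ^ n in [0, 1[ such that x - m / p ^ n lies in Z_p. *)
Definition padic_frac (x : Qp) : rat :=
  xget 0 [set r : rat | exists m n : nat, [/\ (m < p ^ n)%N,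
    r = m%:R / p%:R ^+ n & padic_abs (x - m%:R / p%:R ^+ n) <= 1]].

(* exp (2 * pi * i * {x}), written out by Euler's formula. *)
Definition padic_chi (x : Qp) : R[i] :=
  cos (2 * pi * ratr (padic_frac x)) +i* sin (2 * pi * ratr (padic_frac x)).

Definition cintegral (mu : {measure set padic_vec -> \bar R})
    (A : set padic_vec) (f : Qpd -> R[i]) : R[i] :=
  (\int[mu]_(x in A) complex.Re (f x)) +i* (\int[mu]_(x in A) complex.Im (f x)).

Definition maxnorm_density (mu : {measure set padic_vec -> \bar R})
    (sigma b t : R) (x : Qpd) : R[i] :=
  cintegral mu setT (fun y =>
    padic_chi (dotv x y) * (expR (- (sigma * t * maxnorm y `^ b)))%:C).

End PadicVectors.

Section Skorohod.
Variables (R : realType) (p : nat) (p_pr : prime p) (d : nat).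

Local Notation Qpd := 'rV[padic p_pr]_d.

(* Extension of a path on [0, +oo[ to a function on R; only its values at
   nonnegative times enter the one-sided limits below. *)
Definition path_ext (w : {nonneg R} -> Qpd) (s : R) : Qpd := w `|s|%:nng.

Definition cadlag (w : {nonneg R} -> Qpd) : Prop :=
  forall t : {nonneg R},
    (path_ext w s @[s --> t%:num^'+] --> w t) /\
    (0 < t%:num -> cvg (path_ext w s @[s --> t%:num^'-])).

Lemma cadlag_cst0 : cadlag (fun=> 0).
Proof. by move=> t; split=> [|_]; [exact: cvg_cst | exact: is_cvg_cst]. Qed.

Record skorohod := Skorohod {
  skorohod_path :> {nonneg R} -> Qpd;
  skorohod_cadlag : cadlag skorohod_path }.

HB.instance Definition _ := gen_eqMixin skorohod.
HB.instance Definition _ := gen_choiceMixin skorohod.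
HB.instance Definition _ := isPointed.Build skorohod (Skorohod cadlag_cst0).

Definition cylinders : set (set skorohod) :=
  [set C | exists (t : {nonneg R}) (A : set (padic_vec p_pr d)),
    measurable A /\ C = [set w : skorohod | A (w t)]].

(* The sigma-algebra generated by the evaluations, which is the Borel
   sigma-algebra of the Skorohod topology. *)
Definition skorohod_space := g_sigma_algebraType cylinders.

HB.instance Definition _ := Measurable.on skorohod_space.

Variable P : probability skorohod_space R.

Definition mutually_independent (I : finType)
    (X : I -> skorohod -> padic_vec p_pr d) : Prop :=
  forall A : I -> set (padic_vec p_pr d), (forall i, measurable (A i)) ->
    P (\bigcap_i (X i @^-1` A i)) = (\prod_i P (X i @^-1` A i))%E.

Definition independent_increments : Prop :=
  forall (n : nat) (s t : 'I_n -> {nonneg R}),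
    (forall i, (s i)%:num < (t i)%:num) ->
    trivIset setT (fun i => [set` `](s i)%:num, (t i)%:num]]) ->
    mutually_independent (fun i (w : skorohod) => w (t i) - w (s i)).

Definition maxnorm_law (mu : {measure set (padic_vec p_pr d) -> \bar R})
    (sigma b : R) : Prop :=
  [/\ P [set w : skorohod | w 0%:nng = 0] = 1%E,
      independent_increments
    & forall s t : {nonneg R}, s%:num < t%:num ->
        forall A : set (padic_vec p_pr d), measurable A ->
        (fine (P [set w : skorohod | A (w t - w s)]))%:C =
        cintegral mu A (maxnorm_density mu sigma b (t%:num - s%:num))].

End Skorohod.

Definition alpha (R : realType) (p d : nat) (b : R) : R :=
  1 - (p%:R `^ b - 1) / (p%:R `^ (b + d%:R) - 1).

(* Main.v *)
Require Import Defs.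
From HB Require Import structures.
From mathcomp Require Import all_boot all_order all_algebra.
From mathcomp Require Import all_classical all_reals all_analysis.
From mathcomp Require Import measurable_realfun complex ring lra zify.

Set Implicit Arguments.
Unset Strict Implicit.
Unset Printing Implicit Defensive.

Import Order.TTheory GRing.Theory Num.Theory.
Import numFieldNormedType.Exports.

Local Open Scope classical_set_scope.
Local Open Scope ring_scope.

(** The ball of radius [p ^ r] is a subgroup of [Q_p ^ d]. A path that starts at 0 is
    therefore in the ball at all times of a finite grid if and only if all its
    increments between consecutive grid times are in the ball
    ([stay_ball_grid_increments]). For the grid of mesh [T / 2 ^ n] the increments are
    independent with a common law, so this event has probability [V ^ (2 ^ n)], where
    [V] is the probability that an increment over a time [T / 2 ^ n] is in the ball. As
    [n] grows the events decrease to the event of the theorem, because paths are right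
    continuous ([bigcap_stay_ball_grid]). It remains to compute [V] to first order in
    the time step.

    The density is the Fourier transform of [g y = expR (- c * |y| ^ b)], with [c] the
    product of [sigma] and the time step. Translating the variable of integration by a
    vector [z] with [chi (x . z) <> 1] shows that the oscillating part of the integral
    vanishes ([oscillating_integral_eq0]); for [|x| = p ^ m] what remains is the
    integral of [g] over the ball of radius [p ^ - m], minus a contribution of the next
    sphere ([density_psphere]). Integrated over spheres, this says that the probability
    of the ball of radius [p ^ k] and the average of [g] over the dual ball of radius
    [p ^ - k] have the same increments in [k]; both tend to 1 at infinity, so they are
    equal ([increment_prob_average]).

    Since a ball is the union of the ball one size smaller and of a sphere, the defect
    [D k] from 1 of the average of [g] over the ball of radius [p ^ k] satisfies
    [D k = theta * D (k - 1) + (1 - theta) * (1 - expR (- c * q ^ k))] with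
    [theta = p ^ - d] and [q = p ^ b]. The number [alpha] is such that
    [alpha * q ^ k] solves this recursion for the source [q ^ k]
    ([alpha_fixpoint]), and the recursion contracts, so that [D k] lies between
    [c * alpha * q ^ k / (1 + c * q ^ k)] and [c * alpha * q ^ k]
    ([average_defect_ge], [average_defect_le]). For [c = sigma * T / 2 ^ n] and
    [k = - r], the power [V ^ (2 ^ n)] tends to the exponential of
    [- sigma * alpha * T * q ^ - r] ([cvg_power_expR]). *)

(** * Measure and integration *)

Section Integration.
Variables (disp : measure_display) (X : measurableType disp) (R : realType).
Variable mu : {measure set X -> \bar R}.

Lemma measure_bigcup_finType (I : finType) (F : I -> set X) :
  (forall i, measurable (F i)) -> trivIset setT F ->
  mu (\bigcup_i F i) = (\sum_i mu (F i))%E.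
Proof.
move=> mF tF; rewrite measure_fin_bigcup//; last exact: finite_finset.
rewrite (fsbigE (enum I)) ?enum_uniq//; last first.
  by move=> i _; rewrite mem_enum.
by rewrite -big_enum; apply: eq_bigl => i; rewrite in_setT.
Qed.

Lemma integrable_mul_bounded (D : set X) (f g : X -> R) :
  measurable D -> measurable_fun setT f -> (forall y, `|f y| <= 1) ->
  mu.-integrable D (EFin \o g) -> mu.-integrable D (EFin \o (fun y => f y * g y)).
Proof.
move=> mD mf f1 intg; apply: (le_integrable mD _ _ intg).
  apply/measurable_EFinP; apply: measurable_funM; first exact: measurable_funTS.
  by apply/measurable_EFinP; case/integrableP: intg.
by move=> y _ /=; rewrite lee_fin normrM ler_piMl.
Qed.

Lemma Rintegral_lincomb (D : set X) (u v : R) (f g : X -> R) : measurable D ->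
  mu.-integrable D (EFin \o f) -> mu.-integrable D (EFin \o g) ->
  \int[mu]_(y in D) (u * f y + v * g y) =
  u * \int[mu]_(y in D) f y + v * \int[mu]_(y in D) g y.
Proof.
move=> mD intf intg.
have intZ (f' : X -> R) (w : R) : mu.-integrable D (EFin \o f') ->
    mu.-integrable D (EFin \o (fun y => w * f' y)).
  by move=> intf'; exact: (integrableZl mD w intf').
rewrite (RintegralD mD (intZ f u intf) (intZ g v intg)).
by congr (_ + _); exact: RintegralZl.
Qed.

Lemma probability_setI_full (P : probability X R) (A B : set X) :
  measurable A -> measurable B -> P B = 1%E -> P (A `&` B) = P A.
Proof.
move=> mA mB PB.
have PAB : P (A `\` B) = 0%E.
  apply/eqP; rewrite eq_le measure_ge0 andbT.
  have <- : P (~` B) = 0%E by rewrite probability_setC// PB subee.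
  apply: le_measure; rewrite ?inE; last exact: subIsetr.
    exact: measurableD.
  exact: measurableC.
have -> : P A = (P (A `\` B) + P (A `&` B))%E by exact: measureDI.
by rewrite PAB add0e.
Qed.

End Integration.

(** * Absolute values of rationals *)

Section PrimePowers.
Variables (p : nat) (p_pr : prime p) (K : realFieldType).

Lemma prime_natr_gt1 : 1 < p%:R :> K.
Proof. by rewrite ltr1n prime_gt1. Qed.

Lemma prime_natr_gt0 : 0 < p%:R :> K.
Proof. by rewrite ltr0n prime_gt0. Qed.

Lemma prime_natr_neq0 : p%:R != 0 :> K.
Proof. by rewrite gt_eqF ?prime_natr_gt0. Qed.

Lemma prime_exprz_gt0 (k : int) : 0 < p%:R ^ k :> K.
Proof. by rewrite exprz_gt0 ?prime_natr_gt0. Qed.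

Lemma prime_exprz_neq0 (k : int) : p%:R ^ k != 0 :> K.
Proof. by rewrite gt_eqF ?prime_exprz_gt0. Qed.

Lemma ler_prime_exprz (k l : int) : (p%:R ^ k <= p%:R ^ l :> K) = (k <= l).
Proof. exact: (ler_eXz2l prime_natr_gt1). Qed.

Lemma ltr_prime_exprz (k l : int) : (p%:R ^ k < p%:R ^ l :> K) = (k < l).
Proof. exact: (ltr_eXz2l prime_natr_gt1). Qed.

Lemma prime_exprzD (k l : int) : p%:R ^ (k + l) = p%:R ^ k * p%:R ^ l :> K.
Proof. exact: expfzDr prime_natr_neq0. Qed.

End PrimePowers.

Section RationalAbsoluteValue.
Variables (p : nat) (p_pr : prime p).

Lemma ratabs_int (a : int) : a != 0 ->
  ratabs p a%:~R = p%:R ^ (- (logn p `|a|)%:Z).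
Proof.
move=> a0; rewrite -[X in ratabs _ X]divr1 -[1]/(1%:~R) ratabs_frac//.
by rewrite logn1 expr0 div1r -exprnN.
Qed.

Lemma ratabs_int_le1 (a : int) : ratabs p a%:~R <= 1.
Proof.
have [->|a0] := eqVneq a 0; first by rewrite ratabs0.
by rewrite ratabs_int// -(expr0z p%:R) ler_prime_exprz// oppr_le0.
Qed.

Lemma ratabs_int_le (a : int) (n : nat) :
  (ratabs p a%:~R <= p%:R ^ (- n%:Z)) = (p ^ n %| `|a|)%N.
Proof.
have [->|a0] := eqVneq a 0; first by rewrite ratabs0 dvdn0 ltW ?prime_exprz_gt0.
by rewrite ratabs_int// ler_prime_exprz// lerN2 lez_nat pfactor_dvdn// absz_gt0.
Qed.

Lemma ratabs_value q : q != 0 -> exists k : int, ratabs p q = p%:R ^ k.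
Proof.
move=> q0; rewrite /ratabs (negbTE q0).
exists (Posz (logn p `|denq q|) - Posz (logn p `|numq q|)).
by rewrite prime_exprzD// -exprnN.
Qed.

Lemma ratabs_prime : ratabs p p%:R = p%:R^-1.
Proof.
rewrite -[X in ratabs _ X]/((Posz p)%:~R) ratabs_int.
  by rewrite absz_nat logn_prime// eqxx.
by rewrite eqz_nat -lt0n prime_gt0.
Qed.

(** The denominator of a [p]-adic integer is prime to [p], hence invertible modulo
    [p ^ n] by Bezout; the numerator times this inverse gives [m]. *)
Lemma ratabs_approx_nat q n : ratabs p q <= 1 ->
  exists2 m : nat, (m < p ^ n)%N & ratabs p (q - m%:R) <= p%:R ^ (- n%:Z).
Proof.
move=> q1; set a := numq q; set b := denq q.
have b0 : b != 0 by rewrite denq_neq0.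
have pn0 : (0 < p ^ n)%N by rewrite expn_gt0 prime_gt0.
have pNb : ~~ (p %| `|b|)%N.
  apply/negP => pb; move: q1.
  have q0 : q != 0.
    by apply: contraTneq pb => q0; rewrite /b q0 dvdn1; case: eqP p_pr => // ->.
  have pa : ~~ (p %| `|a|)%N.
    apply/negP => pa; have := coprime_num_den q => /eqP g1.
    have : (p %| 1)%N by rewrite -g1 dvdn_gcd pa.
    by rewrite dvdn1 => /eqP p1; move: p_pr; rewrite p1.
  rewrite /ratabs (negbTE q0) [logn p `|numq q|]lognE (negbTE pa) !andbF expr0 divr1.
  rewrite leNgt exprn_egt1 ?prime_natr_gt1//.
  by rewrite -lt0n logn_gt0 mem_primes p_pr absz_gt0 b0 pb.
have pb0 : logn p `|b| == 0%N by rewrite lognE (negbTE pNb) !andbF.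
have pnb : coprimez b (p ^ n)%N.
  by rewrite coprimezE absz_nat coprimeXr// coprime_sym prime_coprime.
have /coprimezP[[u v] /= uv] := pnb.
pose m := ((a * u) %% (p ^ n)%N)%Z.
have m0 : 0 <= m by rewrite modz_ge0// gt_eqF.
have mE : m%:~R = (`|m|%N)%:R :> rat by rewrite -[in LHS](gez0_abs m0).
exists `|m|%N.
  by rewrite -ltz_nat gez0_abs// ltz_pmod.
have -> : q - (`|m|%N)%:R = (a - m * b)%:~R / b%:~R.
  rewrite -mE intrB intrM mulrBl divq_num_den mulfK ?intr_eq0//.
rewrite ratabsM// -[leRHS]mulr1 ler_pM ?ratabs_ge0//.
  suff : ((p ^ n)%N %| a - m * b)%Z by rewrite ratabs_int_le dvdzE absz_nat.
  have -> : a - m * b = ((a * u) %/ (p ^ n)%N)%Z * (p ^ n)%N * b + a * (v * (p ^ n)%N).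
    have : a * u = ((a * u) %/ (p ^ n)%N)%Z * (p ^ n)%N + m by exact: divz_eq.
    move: (divz _ _) => c auE.
    have : a * (u * b + v * (p ^ n)%N) = a by rewrite uv mulr1.
    by rewrite mulrDr mulrA auE => {1}<-; ring.
  by rewrite mulrA -mulrA [_ * b]mulrC mulrA -mulrDl dvdz_mull.
have : ratabs p b%:~R * ratabs p (b%:~R)^-1 = 1.
  by rewrite -ratabsM// divff ?ratabs1 ?intr_eq0.
have -> : ratabs p b%:~R = 1.
  by rewrite ratabs_int// (eqP pb0) oppr0 expr0z.
by rewrite mul1r => ->.
Qed.

End RationalAbsoluteValue.

(** * Approximation of p-adic numbers *)

Section PadicNumbers.
Variables (p : nat) (p_pr : prime p).

Local Notation Qp := (padic p_pr).

Lemma const_padic_cauchy (q : rat) : (fun=> q) \in padic_cauchy p_pr.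
Proof. by apply/asboolP => e e0; exists 0%N => m n _ _; rewrite subrr ratabs0. Qed.

Definition padic_of_rat (q : rat) : Qp := padic_pi (PadicSeq (const_padic_cauchy q)).

Lemma padic_of_rat_is_zmod_morphism : zmod_morphism padic_of_rat.
Proof.
move=> x y; rewrite /padic_of_rat -rmorphB; congr padic_pi.
exact: val_inj.
Qed.

Lemma padic_of_rat_is_monoid_morphism : monoid_morphism padic_of_rat.
Proof.
split=> [|x y].
  by rewrite -(rmorph1 (@padic_pi p p_pr)); congr padic_pi; exact: val_inj.
rewrite /padic_of_rat -rmorphM; congr padic_pi.
exact: val_inj.
Qed.

HB.instance Definition _ := GRing.isZmodMorphism.Build rat Qp padic_of_rat
  padic_of_rat_is_zmod_morphism.
HB.instance Definition _ := GRing.isMonoidMorphism.Build rat Qp padic_of_rat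
  padic_of_rat_is_monoid_morphism.

Lemma padic_abs_of_rat (q : rat) : padic_abs (padic_of_rat q) = ratabs p q.
Proof.
have [->|q0] := eqVneq q 0; first by rewrite rmorph0 padic_abs0 ratabs0.
have : padic_of_rat q != 0 by rewrite fmorph_eq0.
by move=> /padic_absE[N /(_ N (leqnn N))] <-.
Qed.

Lemma padic_abs_value (x : Qp) : x != 0 -> exists k : int, padic_abs x = p%:R ^ k.
Proof.
rewrite -{1 2}(padic_reprK x) => x0.
have [N /(_ N (leqnn N)) xN] := padic_absE x0.
have : padic_abs (padic_pi (padic_repr x)) != 0 by rewrite padic_abs_eq0.
by rewrite -xN ratabs_eq0// => /(ratabs_value p_pr).
Qed.

Lemma padic_abs_prime : padic_abs (p%:R : Qp) = p%:R^-1.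
Proof. by rewrite -(rmorph_nat padic_of_rat) padic_abs_of_rat ratabs_prime. Qed.

Lemma padic_prime_neq0 : p%:R != 0 :> Qp.
Proof. by rewrite -padic_abs_eq0 padic_abs_prime invr_eq0 prime_natr_neq0. Qed.

Lemma padic_abs1 : padic_abs (1 : Qp) = 1.
Proof. by rewrite -(rmorph1 padic_of_rat) padic_abs_of_rat ratabs1. Qed.

Lemma padic_absV (x : Qp) : padic_abs x^-1 = (padic_abs x)^-1.
Proof.
have [->|x0] := eqVneq x 0; first by rewrite invr0 padic_abs0 invr0.
apply: (mulfI (x := padic_abs x)); first by rewrite padic_abs_eq0.
by rewrite -padic_absM !divff ?padic_abs1 ?padic_abs_eq0.
Qed.

Lemma padic_abs_primeX (k : int) : padic_abs (p%:R ^ k : Qp) = p%:R ^ (- k).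
Proof.
have absX n : padic_abs ((p%:R : Qp) ^+ n) = p%:R ^- n.
  elim: n => [|n IHn]; first by rewrite !expr0 padic_abs1 invr1.
  by rewrite exprS padic_absM padic_abs_prime IHn -invfM -exprS.
case: k => n; first by rewrite absX exprnN.
by rewrite NegzE opprK -exprnN padic_absV absX invrK.
Qed.

Lemma padic_abs_int_le1 (a : int) : padic_abs (a%:~R : Qp) <= 1.
Proof. by rewrite -(rmorph_int padic_of_rat) padic_abs_of_rat ratabs_int_le1. Qed.

Lemma padic_abs_nat_le1 (a : nat) : padic_abs (a%:R : Qp) <= 1.
Proof. exact: (padic_abs_int_le1 a). Qed.

Lemma padic_absD_le (x y : Qp) e :
  padic_abs x <= e -> padic_abs y <= e -> padic_abs (x + y) <= e.
Proof. by move=> xe ye; rewrite (le_trans (padic_abs_max _ _))// ge_max xe. Qed.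

Lemma padic_absB_le (x y : Qp) e :
  padic_abs x <= e -> padic_abs y <= e -> padic_abs (x - y) <= e.
Proof. by move=> xe ye; rewrite padic_absD_le// padic_absN. Qed.

Lemma padic_rat_dense (x : Qp) (e : rat) : 0 < e ->
  exists q : rat, padic_abs (x - padic_of_rat q) < e.
Proof.
move=> e0; have /asboolP/(_ e e0)[N xN] := valP (padic_repr x).
exists (padic_repr x N); set q := padic_repr x N.
have [->|] := eqVneq (x - padic_of_rat q) 0; first by rewrite padic_abs0.
rewrite -{1 2}(padic_reprK x) -rmorphB => /padic_absE[M yM].
rewrite -(yM (maxn M N)) ?leq_maxl//.
by apply: xN; rewrite ?leq_maxr.
Qed.

(** Rationals are dense, and a rational that is a [p]-adic integer is congruent
    to a natural number modulo any power of [p]. *)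
Lemma padic_approx_nat (x : Qp) (n : nat) : padic_abs x <= 1 ->
  exists2 m : nat, (m < p ^ n)%N & padic_abs (x - m%:R) <= p%:R ^ (- n%:Z).
Proof.
move=> x1.
have [q xq] := padic_rat_dense x (prime_exprz_gt0 p_pr rat (- n%:Z)).
have xq1 : padic_abs (x - padic_of_rat q) <= 1.
  apply: le_trans (ltW xq) _.
  by rewrite -[leRHS](expr0z p%:R) ler_prime_exprz// oppr_le0.
have q1 : ratabs p q <= 1.
  rewrite -padic_abs_of_rat.
  have -> : padic_of_rat q = x - (x - padic_of_rat q) by ring.
  exact: padic_absB_le.
have [m mn qm] := ratabs_approx_nat p_pr n q1.
exists m => //.
have -> : x - m%:R = (x - padic_of_rat q) + padic_of_rat (q - m%:R).
  by rewrite rmorphB rmorph_nat addrA subrK.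
by rewrite padic_absD_le ?(ltW xq)// padic_abs_of_rat.
Qed.

Lemma padic_abs_nat_lt1 (a : nat) :
  (padic_abs (a%:R : Qp) <= p%:R^-1) = (p %| a)%N.
Proof.
rewrite -(rmorph_nat padic_of_rat) padic_abs_of_rat.
by rewrite -{2}(expn1 p) -(ratabs_int_le p_pr (Posz a) 1) -exprnN expr1.
Qed.

End PadicNumbers.

(** * The additive character *)

Section Character.
Variables (R : realType) (p : nat) (p_pr : prime p).

Local Notation Qp := (padic p_pr).

(** The rationals with a power of [p] as denominator meet the [p]-adic integers
    in the rational integers; this is why [padic_frac] is well defined, and
    additive modulo the integers. *)
Lemma ratabs_le1_int (a : int) (n : nat) :
  ratabs p (a%:~R / p%:R ^+ n) <= 1 -> exists z : int, a%:~R / p%:R ^+ n = z%:~R :> rat.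
Proof.
have pn0 : p%:R ^+ n != 0 :> rat by rewrite expf_neq0 ?prime_natr_neq0.
move=> a1; have : (p ^ n %| `|a|)%N.
  rewrite -ratabs_int_le// -[a%:~R](divfK pn0) ratabsM//.
  have -> : ratabs p (p%:R ^+ n) = p%:R ^ (- n%:Z).
    rewrite -exprnN; elim: (n) => [|m IHm]; first by rewrite !expr0 ratabs1 invr1.
    by rewrite exprS ratabsM// ratabs_prime// IHm -invfM -exprS.
  by rewrite -[leRHS]mul1r ler_pM2r ?prime_exprz_gt0.
rewrite -[X in (X %| _)%N]absz_nat -dvdzE => /dvdzP[z ->].
by exists z; rewrite intrM -[(Posz _)%:~R]/((p ^ n)%:R) natrX mulfK.
Qed.

Lemma padic_fracP (x : Qp) : exists m n : nat, [/\ (m < p ^ n)%N,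
  padic_frac x = m%:R / p%:R ^+ n &
  padic_abs (x - padic_of_rat p_pr (padic_frac x)) <= 1].
Proof.
have pn0 n : p%:R ^+ n != 0 :> Qp by rewrite expf_neq0 ?padic_prime_neq0.
have of_ratE m n : padic_of_rat p_pr (m%:R / p%:R ^+ n) = m%:R / p%:R ^+ n.
  by rewrite fmorph_div rmorphXn/= !rmorph_nat.
suff [r [m [n [mn rE xr]]]] : exists r : rat, exists m n : nat, [/\ (m < p ^ n)%N,
    r = m%:R / p%:R ^+ n & padic_abs (x - m%:R / p%:R ^+ n) <= 1].
  have [m' [n' [mn' rE' xr']]] : [set r : rat | exists m n : nat, [/\ (m < p ^ n)%N,
    r = m%:R / p%:R ^+ n & padic_abs (x - m%:R / p%:R ^+ n) <= 1]] (padic_frac x).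
    by apply: xgetPex; exists r, m, n.
  by exists m', n'; split; rewrite // rE' of_ratE.
(* [p ^ n * x] is integral, and its residue modulo [p ^ n] is the numerator. *)
have [n xn] : exists n : nat, padic_abs x <= p%:R ^+ n.
  have [->|/padic_abs_value[k ->]] := eqVneq x 0.
    by exists 0%N; rewrite padic_abs0.
  exists `|k|%N; rewrite -[leRHS]/(p%:R ^ (Posz `|k|)) ler_prime_exprz//.
  by rewrite abszE ler_norm.
have absn : padic_abs ((p%:R : Qp) ^+ n) = p%:R ^ (- n%:Z).
  exact: (padic_abs_primeX p_pr n%:Z).
have [] := @padic_approx_nat p p_pr (p%:R ^+ n * x) n.
  rewrite padic_absM absn -exprnN mulrC ler_pdivrMr ?mul1r//.
  by rewrite exprn_gt0 ?prime_natr_gt0.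
move=> m mn xm; exists (m%:R / p%:R ^+ n), m, n; split => //.
rewrite -(ler_pM2l (prime_exprz_gt0 p_pr rat (- n%:Z))) -absn -padic_absM mulr1.
by rewrite mulrBr mulrCA divff// mulr1 absn.
Qed.

Lemma padic_frac_eqmod (x : Qp) (a : int) (n : nat) :
  padic_abs (x - padic_of_rat p_pr (a%:~R / p%:R ^+ n)) <= 1 ->
  exists z : int, a%:~R / p%:R ^+ n = padic_frac x + z%:~R.
Proof.
move=> xa; have [m [k [mk fE xf]]] := padic_fracP x.
have pn0 i : p%:R ^+ i != 0 :> rat by rewrite expf_neq0 ?prime_natr_neq0.
have dE : a%:~R / p%:R ^+ n - padic_frac x =
    (a * Posz (p ^ k) - Posz m * Posz (p ^ n))%:~R / p%:R ^+ (n + k).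
  rewrite fE intrB !intrM -![(Posz _)%:~R]/(_%:R) !natrX exprD.
  by field; rewrite !pn0.
have [|z zE] :=
    @ratabs_le1_int (a * Posz (p ^ k) - Posz m * Posz (p ^ n)) (n + k).
  rewrite -dE -(padic_abs_of_rat p_pr) rmorphB -[X in X - _](subrK x).
  by rewrite -addrA padic_absD_le// -padic_absN opprB.
by exists z; rewrite -zE -dE addrC subrK.
Qed.

Lemma padic_fracD (x y : Qp) :
  exists z : int, padic_frac (x + y) = padic_frac x + padic_frac y + z%:~R.
Proof.
have [m [k [_ fE xf]]] := padic_fracP x; have [m' [k' [_ fE' yf]]] := padic_fracP y.
have pn0 i : p%:R ^+ i != 0 :> rat by rewrite expf_neq0 ?prime_natr_neq0.
have sE : padic_frac x + padic_frac y =
    (Posz m * Posz (p ^ k') + Posz m' * Posz (p ^ k))%:~R / p%:R ^+ (k + k').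
  rewrite fE fE' intrD !intrM -![(Posz _)%:~R]/(_%:R) !natrX exprD.
  by field; rewrite !pn0.
have [|z zE] := @padic_frac_eqmod (x + y)
    (Posz m * Posz (p ^ k') + Posz m' * Posz (p ^ k)) (k + k').
  rewrite -sE.
  have -> : x + y - padic_of_rat p_pr (padic_frac x + padic_frac y) =
      (x - padic_of_rat p_pr (padic_frac x)) + (y - padic_of_rat p_pr (padic_frac y)).
    by rewrite [padic_of_rat p_pr (_ + _)]rmorphD opprD addrACA.
  exact: padic_absD_le.
by exists (- z); rewrite sE zE intrN addrK.
Qed.

Lemma cosD2piz (t : R) (z : int) : cos (t + 2 * pi * z%:~R) = cos t.
Proof.
have nat_case s n : cos (s + 2 * pi * n%:R) = cos s :> R.
  by rewrite [2 * pi]mulr_natl mulr_natr (periodicn (@cosD2pi R)).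
case: z => n; first exact: nat_case.
by rewrite -(nat_case _ n.+1) NegzE intrN mulrN subrK.
Qed.

Lemma sinD2piz (t : R) (z : int) : sin (t + 2 * pi * z%:~R) = sin t.
Proof.
have nat_case s n : sin (s + 2 * pi * n%:R) = sin s :> R.
  by rewrite [2 * pi]mulr_natl mulr_natr (periodicn (@sinD2pi R)).
case: z => n; first exact: nat_case.
by rewrite -(nat_case _ n.+1) NegzE intrN mulrN subrK.
Qed.

Lemma padic_chiD (x y : Qp) :
  padic_chi R (x + y) = padic_chi R x * padic_chi R y.
Proof.
have [z zE] := padic_fracD x y; rewrite /padic_chi zE.
have ratrD a b : ratr (a + b) = ratr a + ratr b :> R by exact: raddfD.
rewrite !ratrD ratr_int !(mulrDr (2 * pi)) cosD2piz sinD2piz cosD sinD.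
by apply/eqP; rewrite eq_complex/= addrC eqxx [X in _ == X]addrC eqxx.
Qed.

Lemma padic_chi_int (x : Qp) : padic_abs x <= 1 -> padic_chi R x = 1.
Proof.
move=> x1; have [|z] := @padic_frac_eqmod x 0 0.
  by rewrite mul0r rmorph0 subr0.
rewrite mul0r => /esym/eqP; rewrite addr_eq0 => /eqP fE.
rewrite /padic_chi fE -intrN ratr_int -[_ * _]add0r cosD2piz sinD2piz.
by rewrite cos0 sin0.
Qed.

(** The value is exp (2 pi i / p), and the cosine is injective on [0, pi], which
    contains 2 pi / p. *)
Lemma padic_chi_primeV : padic_chi R ((p%:R : Qp)^-1) != 1.
Proof.
have [|z zE] := @padic_frac_eqmod (p%:R^-1) 1 1.
  by rewrite mul1r expr1 fmorphV rmorph_nat subrr padic_abs0.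
rewrite /padic_chi -(addrK z%:~R (padic_frac _)) -zE mul1r expr1.
have -> : ratr (p%:R^-1 - z%:~R) = p%:R^-1 + (- z)%:~R :> R.
  by rewrite rmorphB fmorphV/= ratr_int ratr_nat intrN.
rewrite (mulrDr (2 * pi)) cosD2piz sinD2piz eq_complex/= negb_and.
apply/orP; left; apply/eqP => c1; have p0 := prime_natr_gt0 p_pr R.
have : 2 * pi / p%:R = 0 :> R.
  apply: cos_inj; rewrite ?in_itv/= ?lexx ?pi_ge0//.
  - rewrite divr_ge0 ?mulr_ge0 ?pi_ge0 ?(ltW p0)//=.
    rewrite ler_pdivrMr// mulrC ler_pM2l ?pi_gt0//.
    by rewrite ler_nat prime_gt1.
  - by rewrite c1 cos0.
by apply/eqP; rewrite mulf_neq0 ?invr_eq0 ?gt_eqF// mulr_gt0// pi_gt0.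
Qed.

End Character.

(** * Balls, topology and norm of the vector space *)

Section PadicBalls.
Variables (p : nat) (p_pr : prime p) (d : nat).

Local Notation Qp := (padic p_pr).
Local Notation Qpd := 'rV[padic p_pr]_d.

Definition pball (k : int) : set (padic_vec p_pr d) :=
  [set x : Qpd | forall i, padic_abs (x ord0 i) <= p%:R ^ k].

Definition psphere (k : int) : set (padic_vec p_pr d) := pball k `\` pball (k - 1).

Lemma pball0 k : pball k 0.
Proof. by move=> i; rewrite mxE padic_abs0 ltW ?prime_exprz_gt0. Qed.

Lemma pballN k (x : Qpd) : pball k x -> pball k (- x).
Proof. by move=> xk i; rewrite mxE padic_absN; exact: xk. Qed.

Lemma pballD k (x y : Qpd) : pball k x -> pball k y -> pball k (x + y).
Proof. by move=> xk yk i; rewrite mxE; apply: padic_absD_le; [exact: xk|exact: yk]. Qed.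

Lemma pballB k (x y : Qpd) : pball k x -> pball k y -> pball k (x - y).
Proof. by move=> xk yk; apply: pballD => //; exact: pballN. Qed.

Lemma pballDr k (x z : Qpd) : pball k z -> pball k (x + z) <-> pball k x.
Proof.
move=> zk; split=> [xzk|xk]; last exact: pballD.
by rewrite -(addrK z x); exact: pballB.
Qed.

Lemma subset_pball k l : k <= l -> pball k `<=` pball l.
Proof. by move=> kl x xk i; rewrite (le_trans (xk i))// ler_prime_exprz. Qed.

Lemma pball_dot k l (x y : Qpd) :
  pball k x -> pball l y -> padic_abs (dotv x y) <= p%:R ^ (k + l).
Proof.
move=> xk yl; rewrite /dotv; elim/big_ind: _ => [|u v|i _].
- by rewrite padic_abs0 ltW ?prime_exprz_gt0.
- exact: padic_absD_le.
- by rewrite padic_absM prime_exprzD// ler_pM ?padic_abs_ge0.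
Qed.

Lemma dotvD (x y z : Qpd) : dotv x (y + z) = dotv x y + dotv x z.
Proof. by rewrite /dotv -big_split; apply: eq_bigr => i _; rewrite mxE mulrDr. Qed.

(** The absolute values that occur are powers of [p], so that each nonzero
    vector lies on a single sphere. *)
Lemma psphere_coord k (x : Qpd) : psphere k x ->
  exists2 i, padic_abs (x ord0 i) = p%:R ^ k & pball k x.
Proof.
move=> [xk /existsNP[i /negP]]; rewrite -ltNge => ki; exists i => //.
have [x0|x0] := eqVneq (x ord0 i) 0.
  by move: ki; rewrite x0 padic_abs0 ltNge ltW ?prime_exprz_gt0.
have [l lE] := padic_abs_value x0; have := xk i; move: ki.
rewrite lE ltr_prime_exprz// ler_prime_exprz// => kl lk.
have -> // : l = k by lia.
Qed.

Lemma psphere_ex (x : Qpd) : x != 0 -> exists k, psphere k x.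
Proof.
move=> x0; have [j xj] : exists j, x ord0 j != 0.
  apply/existsP; rewrite -negb_forall; apply: contra x0 => /forallP x0.
  by apply/eqP/rowP => j; rewrite mxE; exact/eqP.
have [i _ imax] :=
  @Order.TotalTheory.arg_maxP _ _ _ j xpredT (fun i => padic_abs (x ord0 i)) isT.
have xi : x ord0 i != 0.
  rewrite -padic_abs_eq0 gt_eqF// (lt_le_trans _ (imax j isT))//.
  by rewrite lt_neqAle padic_abs_ge0 andbT eq_sym padic_abs_eq0.
have [k kE] := padic_abs_value xi; exists k; split=> [l|/(_ i)].
  by rewrite -kE; exact: imax.
by rewrite kE ler_prime_exprz//; lia.
Qed.

Lemma pball_ex (x : Qpd) : exists k, pball k x.
Proof.
have [->|/psphere_ex[k [xk _]]] := eqVneq x 0; first by exists 0; exact: pball0.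
by exists k.
Qed.

Lemma bigcup_pball : \bigcup_(n : nat) pball n%:Z = setT.
Proof.
apply/seteqP; split=> // x _; have [k xk] := pball_ex x.
by exists `|k|%N => //; apply: subset_pball xk; lia.
Qed.

(** Since the balls [pball k] are subgroups that form a basis of neighbourhoods of 0,
    topological questions reduce to stability under adding small vectors. *)
Lemma padic_vec_openP (A : set Qpd) :
  open A <-> forall x, A x -> exists k, forall z, pball k z -> A (x + z).
Proof.
rewrite openE/interior; split=> [oA x /oA|oA x Ax].
  move=> /nbhs_ballP[e /= e0 xeA].
  have [k ke] : exists k : int, p%:R ^ k < e.
    exists (- (Num.bound (e^-1))%:Z); rewrite -exprnN -[ltRHS]invrK.
    rewrite ltf_pV2 ?posrE ?invr_gt0// ?exprn_gt0 ?prime_natr_gt0//.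
    rewrite (lt_trans (archi_boundP _)) ?invr_ge0 ?ltW//.
    by rewrite -natrX ltr_nat ltn_expl// prime_gt1.
  exists k => z zk; apply: xeA; split=> // i j; rewrite (@ballEmdist rat Qp) ord1/=.
  change (padic_abs (x ord0 j - (x + z) ord0 j) < e).
  rewrite mxE opprD addrA subrr add0r padic_absN.
  exact: le_lt_trans (zk j) ke.
have [k kA] := oA x Ax; apply/nbhs_ballP; exists (p%:R ^ k) => /=.
  exact: prime_exprz_gt0.
move=> y [_ xy]; rewrite -(subrKC x y); apply: kA => i.
have : padic_abs (x ord0 i - y ord0 i) < p%:R ^ k.
  by have := xy ord0 i; rewrite (@ballEmdist rat Qp).
by rewrite -padic_absN opprB !mxE => /ltW.
Qed.

Lemma open_measurable_padic (A : set Qpd) :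
  open A -> measurable (A : set (padic_vec p_pr d)).
Proof. exact: sub_sigma_algebra. Qed.

Lemma measurable_pball k : measurable (pball k).
Proof.
apply: open_measurable_padic; apply/padic_vec_openP => x xk.
by exists k => z zk; exact: pballD.
Qed.

Lemma measurable_psphere k : measurable (psphere k).
Proof. by apply: measurableD; exact: measurable_pball. Qed.

Lemma bigcap_pball : \bigcap_(n : nat) pball (- n%:Z) = [set (0 : Qpd)].
Proof.
apply/seteqP; split=> x; last by move=> -> n _; exact: pball0.
move=> xn /=; apply: contrapT => /eqP/psphere_ex[k [_ ]]; apply.
by apply: subset_pball (xn `|k - 1|%N I); lia.
Qed.

Lemma measurable_padic0 : measurable ([set 0] : set (padic_vec p_pr d)).
Proof.
by rewrite -bigcap_pball; apply: bigcapT_measurable => n; exact: measurable_pball.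
Qed.

Lemma measurable_locally_constant d' (T : measurableType d')
    (f : padic_vec p_pr d -> T) :
  (forall x : Qpd, exists k, forall z, pball k z -> f (x + z) = f x) ->
  measurable_fun setT f.
Proof.
move=> floc _ B _; rewrite setTI; apply: open_measurable_padic.
apply/padic_vec_openP => x Bfx; have [k kf] := floc x.
by exists k => z /kf /= ->.
Qed.

Definition translation (z : Qpd) (y : padic_vec p_pr d) : padic_vec p_pr d :=
  (y : Qpd) + z.

Lemma measurable_translation (z : Qpd) : measurable_fun setT (translation z).
Proof.
apply: (@measurability _ _ (padic_vec p_pr d) (padic_vec p_pr d) setT _
  (@open Qpd)) => //.
move=> _ [B oB <-]; rewrite setTI.
apply: open_measurable_padic; apply/padic_vec_openP => x Bx.
have [k kB] := (padic_vec_openP _).1 oB _ Bx.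
by exists k => y yk /=; rewrite /translation addrAC; exact: kB.
Qed.

Variable R : realType.

Lemma ratr_prime_exprz k : ratr (p%:R ^ k) = p%:R ^ k :> R.
Proof.
case: k => n; first by rewrite -!exprnP rmorphXn/= ratr_nat.
by rewrite NegzE -!exprnN fmorphV rmorphXn/= ratr_nat.
Qed.

Lemma maxnorm_le k (x : Qpd) : (maxnorm R x <= p%:R ^ k) <-> pball k x.
Proof.
rewrite /maxnorm -ratr_prime_exprz; split=> [/bigmax_leP[_ xk] i|xk].
  by have := xk i isT; rewrite ler_rat.
apply/bigmax_leP; split=> [|i _]; last by rewrite ler_rat; exact: xk.
by rewrite ler0q ltW ?prime_exprz_gt0.
Qed.

Lemma maxnorm_psphere k (x : Qpd) : psphere k x -> maxnorm R x = p%:R ^ k.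
Proof.
move=> /psphere_coord[i xi xk]; apply/eqP; rewrite eq_le; apply/andP; split.
  exact/maxnorm_le.
rewrite -ratr_prime_exprz -xi.
exact: (le_bigmax _ (fun i => ratr (padic_abs (x ord0 i)))).
Qed.

Lemma maxnorm_ge0 (x : Qpd) : 0 <= maxnorm R x.
Proof. by rewrite /maxnorm; elim/big_rec: _ => // i y _ y0; rewrite le_max y0 orbT. Qed.

Lemma maxnorm0 : maxnorm R (0 : Qpd) = 0.
Proof.
apply/le_anti; rewrite maxnorm_ge0 andbT; apply: bigmax_le => // i _.
by rewrite mxE padic_abs0 raddf0.
Qed.

Lemma psphereDr k (x z : Qpd) : pball (k - 1) z -> psphere k (x + z) <-> psphere k x.
Proof.
move=> zk; rewrite /psphere /setD /= (pballDr _ zk) (pballDr _ (subset_pball _ zk))//.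
by lia.
Qed.

(** This makes radial functions invariant under [pball k] outside of that ball,
    although they are not constant there. *)
Lemma maxnormDr k (x z : Qpd) : ~ pball k x -> pball k z ->
  maxnorm R (x + z) = maxnorm R x.
Proof.
move=> xk zk; have x0 : x != 0 by apply: contra_not_neq xk => ->; exact: pball0.
have [l xl] := psphere_ex x0.
have kl : k <= l - 1.
  rewrite leNgt; apply/negP => lk; apply: xk; case: xl => + _.
  by apply: subset_pball; lia.
rewrite (maxnorm_psphere xl); apply: maxnorm_psphere.
by apply/psphereDr => //; exact: subset_pball zk.
Qed.

(** The norm is locally constant away from 0. *)
Lemma measurable_maxnorm :
  measurable_fun setT (@maxnorm R p p_pr d : padic_vec p_pr d -> R).
Proof.
apply: (measurability _ (RGenOInfty.measurableE R)).
move=> _ [_ [a ->] <-]; rewrite setTI.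
have [a0|a0] := ltP a 0.
  rewrite (_ : _ @^-1` _ = setT)//; apply/seteqP; split=> // x _ /=.
  by rewrite in_itv/= andbT (lt_le_trans a0)// maxnorm_ge0.
apply: open_measurable_padic; apply/padic_vec_openP => x.
rewrite /= in_itv/= andbT => ax.
have x0 : x != 0 by apply: contraTneq ax => ->; rewrite maxnorm0 -leNgt.
have [k [_ xk]] := psphere_ex x0.
by exists (k - 1) => z zk /=; rewrite in_itv/= andbT (maxnormDr xk zk).
Qed.

End PadicBalls.

(** * Haar measure *)

Section Haar.
Variables (R : realType) (p : nat) (p_pr : prime p) (d : nat).
Variable mu : {measure set (padic_vec p_pr d) -> \bar R}.
Hypothesis mu_haar : normalized_haar mu.

Local Notation Qp := (padic p_pr).
Local Notation Qpd := 'rV[padic p_pr]_d.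
Local Notation pball := (@pball p p_pr d).
Local Notation translation := (@translation p p_pr d).
Local Notation psphere := (@psphere p p_pr d).

Lemma haar_translation (z : Qpd) (A : set (padic_vec p_pr d)) : measurable A ->
  mu (translation z @^-1` A) = mu A.
Proof.
move=> mA; rewrite -(mu_haar.1 (- z) A mA); congr (mu _).
apply/seteqP; split=> [y Ay|_ [y Ay <-]].
  by exists ((y : Qpd) + z) => //=; rewrite addrC addrK.
by rewrite /preimage/= /translation addrAC addNr add0r.
Qed.

Definition digit_vector (k : int) (a : {ffun 'I_d -> 'I_p}) : Qpd :=
  \row_i ((a i)%:R * p%:R ^ (- k)).

Lemma pball_digits (k : int) :
  pball k = \bigcup_a (translation (- digit_vector k a) @^-1` pball (k - 1)).
Proof.
have absk : padic_abs (p%:R ^ (- k) : Qp) = p%:R ^ k by rewrite padic_abs_primeX opprK.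
apply/seteqP; split=> [x xk|x [a _ xa]].
  have dig i : exists m : 'I_p,
      padic_abs ((x : Qpd) ord0 i - m%:R * p%:R ^ (- k)) <= p%:R ^ (k - 1).
    have [|m mp xm] := @padic_approx_nat p p_pr (p%:R ^ k * (x : Qpd) ord0 i) 1.
      rewrite padic_absM padic_abs_primeX mulrC -ler_pdivlMr ?prime_exprz_gt0//.
      by rewrite mul1r invr_expz opprK; exact: xk.
    rewrite expn1 in mp; exists (Ordinal mp) => /=.
    have -> : (x : Qpd) ord0 i - m%:R * p%:R ^ (- k) =
        p%:R ^ (- k) * (p%:R ^ k * (x : Qpd) ord0 i - m%:R).
      rewrite mulrBr mulrA -expfzDr ?padic_prime_neq0// addNr expr0z mul1r.
      by rewrite [X in _ - X]mulrC.
    by rewrite padic_absM absk prime_exprzD// ler_pM2l ?prime_exprz_gt0.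
  pose a i := projT1 (cid (dig i)).
  exists [ffun i => a i] => // i; rewrite !mxE ffunE.
  exact: (projT2 (cid (dig i))).
rewrite -[x](subrK (digit_vector k a)); apply: pballD.
  by apply: subset_pball xa; lia.
move=> i; rewrite mxE padic_absM absk -[leRHS]mul1r.
by rewrite ler_pM2r ?prime_exprz_gt0// padic_abs_nat_le1.
Qed.

Lemma trivIset_digits (k : int) :
  trivIset setT (fun a => translation (- digit_vector k a) @^-1` pball (k - 1)).
Proof.
move=> a a' _ _ [x [xa xa']]; apply/ffunP => i; apply/val_inj.
wlog le_a : a a' xa xa' / (a i <= a' i)%N.
  by move=> H; case/orP: (leq_total (a i) (a' i)) => le_a; [|symmetry]; exact: H.
have := pballB xa xa' i; rewrite /translation !mxE.
have -> : (x : Qpd) ord0 i - (a i)%:R * p%:R ^ (- k) -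
    ((x : Qpd) ord0 i - (a' i)%:R * p%:R ^ (- k)) =
    (a' i - a i)%:R * p%:R ^ (- k) :> Qp.
  by rewrite natrB//; ring.
rewrite padic_absM padic_abs_primeX opprK addrC prime_exprzD//.
rewrite ler_pM2r ?prime_exprz_gt0// -[p%:R ^ (-1)]/(p%:R^-1) padic_abs_nat_lt1.
have [lt_a /(dvdn_leq _)|] := ltnP (a i) (a' i); last first.
  by move=> ge_a _; apply/eqP; rewrite eqn_leq le_a.
rewrite subn_gt0 => /(_ lt_a); rewrite leqNgt.
by rewrite (leq_ltn_trans (leq_subr _ _)).
Qed.

(** A ball is the disjoint union of [p ^ d] translates of the ball one size
    smaller, one for each choice of the leading digits of the coordinates. *)
Lemma haar_pballS (k : int) : mu (pball k) = ((p%:R ^+ d)%:E * mu (pball (k - 1)))%E.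
Proof.
rewrite [in LHS]pball_digits measure_bigcup_finType; last exact: trivIset_digits.
  rewrite (eq_bigr (fun=> mu (pball (k - 1)))); last first.
    by move=> a _; rewrite haar_translation//; exact: measurable_pball.
  by rewrite sumr_const card_ffun !card_ord -natrX mule_natl.
move=> a; rewrite -[_ @^-1` _]setTI; apply: measurable_translation => //.
exact: measurable_pball.
Qed.

Definition pball_volume (k : int) : R := (p%:R ^ k) ^+ d.

Lemma pball_volume_gt0 k : 0 < pball_volume k.
Proof. by rewrite exprn_gt0 ?prime_exprz_gt0. Qed.

Lemma pball_volumeS k : pball_volume k = p%:R ^+ d * pball_volume (k - 1).
Proof.
by rewrite /pball_volume -exprMn -[p%:R in RHS]expr1z -prime_exprzD// addrC subrK.
Qed.

Lemma haar_pball (k : int) : mu (pball k) = (pball_volume k)%:E.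
Proof.
have pd0 : p%:R ^+ d != 0 :> R by rewrite expf_neq0 ?prime_natr_neq0.
(* The unit ball has volume 1; the recursion is followed upwards and downwards. *)
have up (n : nat) : mu (pball n%:Z) = (pball_volume n%:Z)%:E.
  elim: n => [|n IHn]; first by rewrite /pball_volume expr0z expr1n -mu_haar.2.
  have nE : n.+1%:Z - 1 = n by lia.
  by rewrite haar_pballS pball_volumeS nE IHn EFinM.
have down (n : nat) : mu (pball (- n%:Z)) = (pball_volume (- n%:Z))%:E.
  elim: n => [|n IHn]; first by rewrite oppr0 up.
  have nE : - n%:Z - 1 = - n.+1%:Z by lia.
  have := IHn; rewrite haar_pballS pball_volumeS nE EFinM.
  move=> /(congr1 (fun x => ((p%:R ^+ d)^-1%:E * x)%E)).
  by rewrite !muleA -!EFinM mulVf// mul1e mul1r.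
case: k => n; first exact: up.
by rewrite NegzE; exact: down.
Qed.

Lemma haar_psphere (k : int) :
  mu (psphere k) = (pball_volume k - pball_volume (k - 1))%:E.
Proof.
have sub : pball k `&` pball (k - 1) = pball (k - 1).
  by apply: setIidr => x; apply: subset_pball; lia.
have fin : (mu (pball k) < +oo)%E by rewrite haar_pball ltry.
have := measureD (@measurable_pball p p_pr d k) (@measurable_pball p p_pr d (k - 1)) fin.
by rewrite sub => ->; rewrite EFinB; congr (_ - _)%E; exact: haar_pball.
Qed.

Lemma integral_translation (z : Qpd) (D : set (padic_vec p_pr d))
    (f : padic_vec p_pr d -> \bar R) :
  measurable D -> measurable_fun D f -> (forall y, D (translation z y) <-> D y) ->
  (\int[mu]_(y in D) f (translation z y) = \int[mu]_(y in D) f y)%E.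
Proof.
move=> mD mf Dz.
have ge0_case (g : padic_vec p_pr d -> \bar R) : measurable_fun D g ->
    (forall y, 0 <= g y)%E ->
    (\int[mu]_(y in D) g (translation z y) = \int[mu]_(y in D) g y)%E.
  move=> mg g0; have zD : translation z @^-1` D = D by apply/seteqP; split=> y /Dz.
  rewrite -{1}zD -(ge0_integral_pushforward (measurable_translation z) mu mD mg)//.
  apply: (@eq_measure_integral _ _ _ _ mu) => [|mt A mA _].
    exact: measurable_translation.
  exact: haar_translation.
rewrite integralE [in RHS]integralE.
rewrite -[fun y => f (translation z y)]/(f \o translation z) funepos_comp funeneg_comp.
congr (_ - _)%E; apply: ge0_case => //; first exact: measurable_funepos.
exact: measurable_funeneg.
Qed.

Lemma Rintegral_translation (z : Qpd) (D : set (padic_vec p_pr d))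
    (f : padic_vec p_pr d -> R) :
  measurable D -> measurable_fun D f -> (forall y, D (translation z y) <-> D y) ->
  \int[mu]_(y in D) f (translation z y) = \int[mu]_(y in D) f y.
Proof.
move=> mD mf Dz; have mEf : measurable_fun D (EFin \o f) by exact/measurable_EFinP.
by congr fine; exact: integral_translation mD mEf Dz.
Qed.

Lemma integrable_pball k (f : padic_vec p_pr d -> R) :
  measurable_fun setT f -> (forall y, `|f y| <= 1) ->
  mu.-integrable (pball k) (EFin \o f).
Proof.
move=> mf f1; apply: measurable_bounded_integrable.
- exact: measurable_pball.
- by rewrite haar_pball ltry.
- exact: measurable_funTS.
- exists 1; split=> // M M1 y _; exact: le_trans (f1 y) (ltW M1).
Qed.

Lemma Rintegral_pball k (f : padic_vec p_pr d -> R) :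
  measurable_fun setT f -> (forall y, `|f y| <= 1) ->
  \int[mu]_(y in pball k) f y =
  \int[mu]_(y in pball (k - 1)) f y + \int[mu]_(y in psphere k) f y.
Proof.
move=> mf f1; have kE : pball (k - 1) `|` psphere k = pball k.
  by rewrite setDUK// => x; apply: subset_pball; lia.
rewrite -Rintegral_setU ?kE//.
- exact: measurable_pball.
- exact: measurable_psphere.
- exact: integrable_pball.
- by apply/disj_setPRL => x [].
Qed.

Lemma Rintegral_psphere_cst k (f : padic_vec p_pr d -> R) (a : R) :
  (forall y, psphere k y -> f y = a) ->
  \int[mu]_(y in psphere k) f y = a * (pball_volume k - pball_volume (k - 1)).
Proof.
move=> fa; rewrite (@eq_Rintegral _ _ _ _ _ (cst a)); last first.
  by move=> y /[!inE]; exact: fa.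
by rewrite Rintegral_cst ?haar_psphere//; exact: measurable_psphere.
Qed.

Lemma Rintegral_pball_cst k (a : R) : \int[mu]_(y in pball k) a = a * pball_volume k.
Proof. by rewrite Rintegral_cst ?haar_pball//; exact: measurable_pball. Qed.

Lemma integrable_pball_cst k (a : R) : mu.-integrable (pball k) (EFin \o cst a).
Proof.
apply: measurable_bounded_integrable => //; first exact: measurable_pball.
  by rewrite haar_pball ltry.
by exists `|a|; split; rewrite ?num_real// => M aM y _; exact: ltW.
Qed.

End Haar.

(** * Integrals of the radial exponential *)

Section RadialExponential.
Variables (R : realType) (p : nat) (p_pr : prime p) (d : nat).
Variable mu : {measure set (padic_vec p_pr d) -> \bar R}.
Hypothesis mu_haar : normalized_haar mu.
Variables (c b : R).
Hypotheses (c_gt0 : 0 < c) (b_gt0 : 0 < b).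

Local Notation Qp := (padic p_pr).
Local Notation Qpd := 'rV[padic p_pr]_d.
Local Notation pball := (@pball p p_pr d).
Local Notation psphere := (@psphere p p_pr d).
Local Notation vol := (pball_volume R p d).
Local Notation q := ((p%:R : R) `^ b).

Definition radial_exp (y : padic_vec p_pr d) : R :=
  expR (- (c * maxnorm R (y : Qpd) `^ b)).

Definition sphere_exp (k : int) : R := expR (- (c * q ^ k)).

Definition ball_exp (k : int) : R := \int[mu]_(y in pball k) radial_exp y.

Lemma exprz_powR (k : int) : (p%:R ^ k : R) `^ b = q ^ k.
Proof.
rewrite -(powR_intmul k (ler0n R p)) -(powR_intmul k (powR_ge0 p%:R b)).
by rewrite -!powRrM mulrC.
Qed.

Lemma primeb_gt1 : 1 < q.
Proof.
have : 1 `^ b < q by apply: gt0_ltr_powR; rewrite ?nnegrE ?ler0n// ltr1n prime_gt1.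
by rewrite powR1.
Qed.

Lemma primeb_exprz_gt0 (k : int) : 0 < q ^ k.
Proof. by rewrite exprz_gt0// (lt_trans _ primeb_gt1). Qed.

Lemma radial_exp_psphere k (y : Qpd) : psphere k y -> radial_exp y = sphere_exp k.
Proof. by move=> yk; rewrite /radial_exp (maxnorm_psphere R yk) exprz_powR. Qed.

Lemma measurable_radial_exp : measurable_fun setT radial_exp.
Proof.
apply: measurableT_comp; first exact: measurable_expR.
have mpow : measurable_fun setT (fun y : padic_vec p_pr d => maxnorm R (y : Qpd) `^ b).
  exact: measurableT_comp (measurable_powR b) (@measurable_maxnorm p p_pr d R).
exact: measurable_funN (measurable_funM (measurable_cst c) mpow).
Qed.

Lemma radial_exp_ge0 y : 0 <= radial_exp y.
Proof. exact: expR_ge0. Qed.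

Lemma radial_exp_le1 y : radial_exp y <= 1.
Proof. by rewrite -expR0 ler_expR oppr_le0 mulr_ge0 ?powR_ge0// ltW. Qed.

Lemma radial_expDr k (y z : Qpd) : ~ pball k y -> pball k z ->
  radial_exp (y + z) = radial_exp y.
Proof. by move=> yk zk; rewrite /radial_exp (maxnormDr R yk zk). Qed.

Lemma radial_exp_norm_le1 y : `|radial_exp y| <= 1.
Proof. by rewrite ger0_norm ?radial_exp_ge0// radial_exp_le1. Qed.

Lemma integrable_radial_exp_pball k : mu.-integrable (pball k) (EFin \o radial_exp).
Proof.
apply: (integrable_pball mu_haar); first exact: measurable_radial_exp.
exact: radial_exp_norm_le1.
Qed.

Lemma ball_expS k :
  ball_exp k = ball_exp (k - 1) + sphere_exp k * (vol k - vol (k - 1)).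
Proof.
rewrite /ball_exp (Rintegral_pball mu_haar); last 2 first.
- exact: measurable_radial_exp.
- exact: radial_exp_norm_le1.
by congr (_ + _); apply: (Rintegral_psphere_cst mu_haar) => y; exact: radial_exp_psphere.
Qed.

Lemma ball_exp_le k : ball_exp k <= vol k.
Proof.
rewrite -[leRHS]mul1r -(Rintegral_pball_cst mu_haar); apply: le_Rintegral.
- exact: measurable_pball.
- exact: integrable_radial_exp_pball.
- exact: (integrable_pball_cst mu_haar).
- by move=> y _; exact: radial_exp_le1.
Qed.

(** An exponential decays faster than any power: with [N * b >= d + 1], the bound
    [expR (- u) <= (N / u) ^ N] beats the volume and leaves a geometric decay. *)
Lemma sphere_exp_decay : exists2 C : R, 0 < C &
  forall n : nat, sphere_exp n%:Z * vol n%:Z <= C / p%:R ^+ n.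
Proof.
pose N := (Num.bound ((d.+1)%:R / b)).+1.
have N0 : 0 < N%:R :> R by rewrite ltr0n.
exists ((N%:R / c) ^+ N); first by rewrite exprn_gt0// divr_gt0.
move=> n; set u := c * q ^+ n.
have u0 : 0 < u by rewrite mulr_gt0// exprn_gt0// (lt_trans _ primeb_gt1).
have exp_le : expR (- u) <= (N%:R / u) ^+ N.
  rewrite expRN -invf_div exprVn lef_pV2 ?posrE ?expR_gt0 ?exprn_gt0 ?divr_gt0//.
  rewrite -[in leRHS](divfK (lt0r_neq0 N0) u) expRM_natr.
  rewrite lerXn2r ?nnegrE ?expR_ge0 ?(ltW (divr_gt0 u0 N0))//.
  by rewrite (le_trans _ (expR_ge1Dx _))// lerDr.
have p0 := prime_natr_gt0 p_pr R; have pn0 : 0 < p%:R ^+ n :> R by rewrite exprn_gt0.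
have qN : p%:R ^+ d.+1 <= q ^+ N.
  rewrite -!powR_mulrn ?powR_ge0 ?(ltW p0)// -powRrM ler_powR//.
    by rewrite ler1n prime_gt0.
  rewrite mulrC -ler_pdivrMr// ltW//; apply: lt_le_trans (archi_boundP _) _.
    by rewrite divr_ge0// ltW.
  by rewrite ler_nat.
rewrite ler_pdivlMr// -mulrA.
have -> : vol n%:Z * p%:R ^+ n = (p%:R ^+ d.+1) ^+ n.
  by rewrite /pball_volume -exprSr -!exprM mulnC.
rewrite -ler_pdivlMr ?exprn_gt0//; apply: le_trans exp_le _.
rewrite /u invfM mulrA exprMn ler_pM2l ?exprn_gt0 ?divr_gt0//.
rewrite exprVn lef_pV2 ?posrE ?exprn_gt0 ?exprn_gt0 ?(lt_trans _ primeb_gt1)//.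
by rewrite [leRHS]exprAC lerXn2r ?nnegrE ?exprn_ge0 ?powR_ge0 ?(ltW p0).
Qed.

Lemma ball_exp_bounded : exists M : R, forall n : nat, ball_exp n%:Z <= M.
Proof.
have [C C0 decay] := sphere_exp_decay.
have p0 := prime_natr_gt0 p_pr R.
(* [1 - p ^ - n] dominates the sum of [p ^ - k] for [1 <= k <= n], as [p >= 2]. *)
suff bnd n : ball_exp n%:Z <= ball_exp 0 + C * (1 - 1 / p%:R ^+ n).
  exists (ball_exp 0 + C) => n; apply: le_trans (bnd n) _.
  by rewrite lerD2l ler_piMr ?(ltW C0)// gerBl divr_ge0// exprn_ge0.
elim: n => [|n IHn]; first by rewrite expr0 divr1 subrr mulr0 addr0.
have nE : n.+1%:Z - 1 = n by lia.
rewrite ball_expS nE; apply: le_trans (lerD IHn (_ : _ <= C / p%:R ^+ n.+1)) _.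
  apply: le_trans (decay n.+1); rewrite ler_pM2l ?expR_gt0//.
  by rewrite gerBl ltW ?pball_volume_gt0.
rewrite -addrA lerD2l -mulrDr ler_pM2l//.
have p2 : 2 <= p%:R :> R by rewrite ler_nat prime_gt1.
set e := (p%:R ^+ n.+1)^-1.
have e0 : 0 <= e by rewrite invr_ge0 exprn_ge0// ltW.
have -> : 1 / p%:R ^+ n = p%:R * e :> R.
  by rewrite /e exprS invfM mulVKf ?gt_eqF// div1r.
have : 2 * e <= p%:R * e by rewrite ler_wpM2r.
by lra.
Qed.

(** Monotone convergence along the exhaustion by balls. *)
Lemma integrable_radial_exp (D : set (padic_vec p_pr d)) : measurable D ->
  mu.-integrable D (EFin \o radial_exp).
Proof.
move=> mD; apply: (integrableS measurableT) => //.
have mE : measurable_fun setT (EFin \o radial_exp).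
  by apply/measurable_EFinP; exact: measurable_radial_exp.
apply/integrableP; split=> //.
have [M ballM] := ball_exp_bounded.
rewrite (eq_integral (EFin \o radial_exp)); last first.
  by move=> y _ /=; rewrite ger0_norm// radial_exp_ge0.
have ndball : {homo (fun n : nat => pball n%:Z) : n m / (n <= m)%N >-> (n <= m)%O}.
  by move=> m n mn; apply/subsetPset => y; apply: subset_pball; lia.
have := @ge0_nondecreasing_set_cvg_integral _ _ _ _ (EFin \o radial_exp) mu ndball.
rewrite bigcup_pball => cvgI.
have {}cvgI := cvgI (fun n => @measurable_pball p p_pr d n) (fun n => measurable_funTS mE)
  (fun n y _ => radial_exp_ge0 y).
rewrite -(cvg_lim _ cvgI)//; apply: le_lt_trans (ltry M).
apply: lime_le; first by apply/cvg_ex; eexists; exact: cvgI.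
apply: nearW => n; have := ballM n; rewrite -lee_fin; apply: le_trans.
have mball : measurable (pball n) by exact: measurable_pball.
by rewrite fineK// integrable_fin_num//; exact: integrable_radial_exp_pball.
Qed.

End RadialExponential.

(** * The density is a Fourier transform *)

Section Density.
Variables (R : realType) (p : nat) (p_pr : prime p) (d : nat).
Variable mu : {measure set (padic_vec p_pr d) -> \bar R}.
Hypothesis mu_haar : normalized_haar mu.

Local Notation Qp := (padic p_pr).
Local Notation Qpd := 'rV[padic p_pr]_d.
Local Notation pball := (@pball p p_pr d).
Local Notation psphere := (@psphere p p_pr d).
Local Notation vol := (pball_volume R p d).

Definition chi_re (x : Qpd) (y : padic_vec p_pr d) : R :=
  complex.Re (padic_chi R (dotv x (y : Qpd))).
Definition chi_im (x : Qpd) (y : padic_vec p_pr d) : R :=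
  complex.Im (padic_chi R (dotv x (y : Qpd))).

Lemma chi_locally_constant (x y : Qpd) :
  exists k, forall z, pball k z -> padic_chi R (dotv x (y + z)) = padic_chi R (dotv x y).
Proof.
have [k xk] := pball_ex x; exists (- k) => z zk.
rewrite dotvD padic_chiD (padic_chi_int _ (x := dotv x z)) ?mulr1//.
by rewrite -(expr0z p%:R) -(addrN k); exact: pball_dot.
Qed.

Lemma measurable_chi_re x : measurable_fun setT (chi_re x).
Proof.
apply: measurable_locally_constant => y.
have [k kchi] := chi_locally_constant x y.
by exists k => z zk; rewrite /chi_re kchi.
Qed.

Lemma measurable_chi_im x : measurable_fun setT (chi_im x).
Proof.
apply: measurable_locally_constant => y.
have [k kchi] := chi_locally_constant x y.
by exists k => z zk; rewrite /chi_im kchi.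
Qed.

Lemma chi_re_norm_le1 x y : `|chi_re x y| <= 1.
Proof. exact: cos_max. Qed.

Lemma chi_im_norm_le1 x y : `|chi_im x y| <= 1.
Proof. exact: sin_max. Qed.

(** The hypotheses say that [u + i v] is fixed by the multiplication by [a + i e], and
    the factor of [u] in the conclusion is the squared modulus of [1 - (a + i e)]. *)
Lemma rotation_fixpoint (K : comNzRingType) (a e u v : K) :
  u = a * u - e * v -> v = a * v + e * u ->
  ((1 - a) ^+ 2 + e ^+ 2) * u = 0.
Proof.
move=> /esym/eqP; rewrite -subr_eq0 => /eqP uE /esym/eqP; rewrite -subr_eq0 => /eqP vE.
rewrite (_ : _ * u = e * (a * v + e * u - v) - (1 - a) * (a * u - e * v - u)).
  by rewrite uE vE !mulr0 subrr.
by ring.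
Qed.

(** Translating the variable of integration multiplies the integral by a value
    of the character other than 1, so the integral vanishes. *)
Lemma oscillating_integral_eq0 (x z : Qpd) (D : set (padic_vec p_pr d))
    (g : padic_vec p_pr d -> R) :
  measurable D -> mu.-integrable D (EFin \o g) ->
  (forall y, D (translation z y) <-> D y) ->
  (forall y, D y -> g (translation z y) = g y) ->
  padic_chi R (dotv x z) != 1 ->
  \int[mu]_(y in D) (chi_re x y * g y) = 0.
Proof.
move=> mD intg Dz gz chiz.
set C := \int[mu]_(y in D) _; pose S := \int[mu]_(y in D) (chi_im x y * g y).
have intc := integrable_mul_bounded mD (measurable_chi_re x) (chi_re_norm_le1 x) intg.
have ints := integrable_mul_bounded mD (measurable_chi_im x) (chi_im_norm_le1 x) intg.
have mEFin (f : padic_vec p_pr d -> R) :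
    mu.-integrable D (EFin \o f) -> measurable_fun D f.
  by move=> /integrableP[/measurable_EFinP].
set a := complex.Re (padic_chi R (dotv x z)).
set e := complex.Im (padic_chi R (dotv x z)).
have reD y : chi_re x (translation z y) = a * chi_re x y - e * chi_im x y.
  rewrite /chi_re /chi_im /translation dotvD padic_chiD /a /e.
  by case: (padic_chi _ _) => u v; case: (padic_chi _ _) => u' v' /=; ring.
have imD y : chi_im x (translation z y) = a * chi_im x y + e * chi_re x y.
  rewrite /chi_re /chi_im /translation dotvD padic_chiD /a /e.
  by case: (padic_chi _ _) => u v; case: (padic_chi _ _) => u' v' /=; ring.
have lincomb (u v : R) := Rintegral_lincomb u v mD intc ints.
have CE : C = a * C - e * S.
  rewrite -mulNr -lincomb {1}/C -(Rintegral_translation mu_haar mD (mEFin _ intc) Dz).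
  apply: eq_Rintegral => y /[!inE] Dy; rewrite reD (gz _ Dy).
  by move: (a) (e) (chi_re x y) (chi_im x y) (g y) => *; ring.
have SE : S = a * S + e * C.
  rewrite addrC -lincomb {1}/S -(Rintegral_translation mu_haar mD (mEFin _ ints) Dz).
  apply: eq_Rintegral => y /[!inE] Dy; rewrite imD (gz _ Dy).
  by move: (a) (e) (chi_re x y) (chi_im x y) (g y) => *; ring.
have /eqP := rotation_fixpoint CE SE.
rewrite mulf_eq0 => /orP[|/eqP//].
rewrite paddr_eq0 ?sqr_ge0// !sqrf_eq0 subr_eq0 => /andP[/eqP a1 /eqP e0].
case/eqP: chiz; apply/eqP; rewrite eq_complex.
by rewrite -[X in X == _]/a -[X in _ && (X == _)]/e -a1 e0 !eqxx.
Qed.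

Variables (sigma b t : R).
Hypotheses (sigmat_gt0 : 0 < sigma * t) (b_gt0 : 0 < b).

Local Notation g := (@radial_exp R p p_pr d (sigma * t) b).
Local Notation h := (@sphere_exp R p (sigma * t) b).
Local Notation G := (@ball_exp R p p_pr d mu (sigma * t) b).

Lemma dual_vector (m : int) (x : Qpd) : psphere m x ->
  exists2 z : Qpd, pball (1 - m) z & dotv x z = p%:R^-1.
Proof.
move=> xm; have [i xi _] := psphere_coord xm.
have xi0 : x ord0 i != 0 by rewrite -padic_abs_eq0 xi prime_exprz_neq0.
exists (\row_j (if j == i then (x ord0 i)^-1 * p%:R^-1 else 0)).
  move=> j; rewrite mxE; case: eqP => _.
    rewrite padic_absM padic_absV xi padic_absV padic_abs_prime invrK.
    by rewrite prime_exprzD// invr_expz expr1z mulrC.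
  by rewrite padic_abs0 ltW ?prime_exprz_gt0.
rewrite /dotv (bigD1 i)//= mxE eqxx mulVKf// big1 ?addr0// => j ji.
by rewrite mxE (negbTE ji) mulr0.
Qed.

(** Where [|y| <= p ^ - m] the character is 1. Over the next larger ball the character
    has integral 0, so that the sphere bounding it, where the radial factor is
    constant, contributes minus the volume of the smaller ball times that constant.
    The complement contributes nothing by oscillation. *)
Lemma density_psphere (m : int) (x : Qpd) : psphere m x ->
  complex.Re (maxnorm_density mu sigma b t x) =
  G (- m) - h (1 - m) * vol (- m).
Proof.
move=> xm; rewrite /maxnorm_density /cintegral /=.
have -> : \int[mu]_y complex.Re (padic_chi R (dotv x y) *
      ((expR (- (sigma * t * maxnorm R y `^ b)))%:C)%C) =
    \int[mu]_y (chi_re x y * g y).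
  apply: eq_Rintegral => y _; rewrite /chi_re /radial_exp.
  by case: (padic_chi _ _) => u v /=; rewrite mulr0 subr0.
have [z zm xz] := dual_vector xm.
have chiz : padic_chi R (dotv x z) != 1 by rewrite xz padic_chi_primeV.
have mB k : measurable (pball k) by exact: measurable_pball.
have mc := measurable_chi_re x; have c1 := chi_re_norm_le1 x.
have intg D : measurable D -> mu.-integrable D (EFin \o (fun y => chi_re x y * g y)).
  move=> mD; apply: integrable_mul_bounded => //.
  exact: integrable_radial_exp.
have mg := @measurable_radial_exp R p p_pr d (sigma * t) b.
have cg1 y : `|chi_re x y * g y| <= 1.
  by rewrite normrM mulr_ile1 ?normr_ge0 ?c1// radial_exp_norm_le1.
rewrite -(setUv (pball (1 - m))) Rintegral_setU//; last 3 first.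
- exact: measurableC.
- by apply: intg; exact: measurableU (mB _) (measurableC (mB _)).
- by apply/disj_setPCl.
have -> : \int[mu]_(y in ~` pball (1 - m)) (chi_re x y * g y) = 0.
  have mC : measurable (~` pball (1 - m)) by exact: measurableC.
  have Cz y : (~` pball (1 - m)) (translation z y) <-> (~` pball (1 - m)) y.
    by rewrite /setC /= /translation (pballDr _ zm).
  have gz y : (~` pball (1 - m)) y -> g (translation z y) = g y.
    by move=> ym; exact: radial_expDr ym zm.
  have igC := integrable_radial_exp mu_haar sigmat_gt0 b_gt0 mC.
  exact: oscillating_integral_eq0 mC igC Cz gz chiz.
rewrite addr0.
rewrite (Rintegral_pball mu_haar (1 - m) (measurable_funM mc mg) cg1).
have mE : 1 - m - 1 = - m by lia.
have chi1 y : pball (- m) y -> chi_re x y = 1.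
  move=> ym; rewrite /chi_re padic_chi_int//.
  by rewrite -(expr0z p%:R) -(addrN m); apply: pball_dot => //; case: xm.
rewrite mE; congr (_ + _).
  apply: eq_Rintegral => y /[!inE] ym.
  by rewrite -[LHS]/(chi_re x y * g y) chi1 ?mul1r.
(* The character integrates to 0 over the ball [1 - m] and to the volume over the
   ball [- m]. *)
have sphere0 : \int[mu]_(y in psphere (1 - m)) chi_re x y = - vol (- m).
  have ball0 : \int[mu]_(y in pball (1 - m)) (chi_re x y * cst 1 y) = 0.
    have Bz y : pball (1 - m) (translation z y) <-> pball (1 - m) y.
      by rewrite /translation; exact: pballDr.
    have ig1 := integrable_pball_cst mu_haar (1 - m) 1.
    by apply: (oscillating_integral_eq0 (mB _) ig1 Bz _ chiz) => y _.
  have := Rintegral_pball mu_haar (1 - m) mc c1; rewrite mE.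
  under [X in X = _ -> _]eq_Rintegral do rewrite -[chi_re x _]mulr1.
  rewrite ball0 (_ : \int[mu]_(y in pball (- m)) _ = vol (- m)).
    by move/eqP; rewrite eq_sym addrC addr_eq0 => /eqP.
  rewrite -[RHS]mul1r -(Rintegral_pball_cst mu_haar).
  by apply: eq_Rintegral => y /[!inE] ym; rewrite chi1.
rewrite -mulrN -sphere0 -RintegralZl//.
- apply: eq_Rintegral => y /[!inE] ym.
  by rewrite -[LHS]/(chi_re x y * g y) mulrC (radial_exp_psphere _ _ ym).
- exact: measurable_psphere.
- apply: (integrableS (mB (1 - m))); [exact: measurable_psphere|by move=> y []|].
  exact: (integrable_pball mu_haar (1 - m) mc c1).
Qed.

End Density.

(** * Contraction and compound interest *)

Section Limits.
Variable R : realType.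

(** Iterating towards minus infinity multiplies a bound by higher and higher
    powers of the factor. *)
Lemma contraction_le0 (theta M : R) (E : int -> R) (K : int) :
  0 <= theta < 1 -> (forall k, k <= K -> E k <= theta * E (k - 1)) ->
  (forall k, k <= K -> E k <= M) -> E K <= 0.
Proof.
move=> /andP[th0 th1] contr bnd.
have iter n : E K <= theta ^+ n * E (K - n%:Z).
  elim: n => [|n IHn]; first by rewrite expr0 mul1r subr0.
  apply: le_trans IHn _; rewrite exprSr -mulrA ler_wpM2l ?exprn_ge0//.
  have -> : K - n.+1%:Z = K - n%:Z - 1 by lia.
  by apply: contr; lia.
have cvg0 : theta ^+ n * M @[n --> \oo] --> (0 : R).
  rewrite -[X in _ --> X](mul0r M); apply: cvgMl.
  by apply: cvg_expr; rewrite ger0_norm.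
rewrite -(cvg_lim _ cvg0)//; apply: limr_ge; first by apply/cvg_ex; exists 0.
apply: nearW => n; apply: le_trans (iter n) _.
by rewrite ler_wpM2l ?exprn_ge0// bnd//; lia.
Qed.

(** Compound-interest limit. The two-sided estimate on the defect [1 - u n] is
    turned into an estimate of the power by [1 + y <= expR y]. *)
Lemma cvg_power_expR (lambda x : R) (N : nat -> nat) (u : nat -> R) :
  0 < lambda -> 0 < x -> (forall n, 0 < N n)%N -> (N n)%:R^-1 @[n --> \oo] --> (0 : R) ->
  (forall n, lambda / ((N n)%:R * (1 + x / (N n)%:R)) <= 1 - u n <= lambda / (N n)%:R) ->
  u n ^+ N n @[n --> \oo] --> expR (- lambda).
Proof.
move=> lambda0 x0 N0 Ncvg ubnd.
have NR n : 0 < (N n)%:R :> R by rewrite ltr0n.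
have cvg_small (y : R) : y / (N n)%:R @[n --> \oo] --> (0 : R).
  by rewrite -[X in _ --> X](mulr0 y); apply: cvgMr.
have cvg_exp (v : nat -> R) : v n @[n --> \oo] --> (0 : R) ->
    expR (- (lambda / (1 + v n))) @[n --> \oo] --> expR (- lambda).
  move=> v0; apply: (@continuous_cvg _ _ _ _ _ _ expR); first exact: continuous_expR.
  have cvg1 : 1 + v n @[n --> \oo] --> (1 : R).
    by rewrite -[X in _ --> X]addr0; apply: cvgD => //; exact: cvg_cst.
  have cvgV1 : (1 + v n)^-1 @[n --> \oo] --> (1 : R).
    by rewrite -[X in _ --> X]invr1; apply: cvgV => //; exact: oner_neq0.
  by rewrite -[lambda in X in _ --> X]mulr1; apply: cvgN; exact: cvgMr.
have small : \forall n \near \oo, lambda / (N n)%:R < 1.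
  by apply: (cvgr_lt _ (cvg_small lambda)); exact: ltr01.
(* Lower bound from [1 - l >= expR (- (l / (1 - l)))], upper bound from
   [1 - l <= expR (- l)]. *)
apply: (squeeze_cvgr _ (cvg_exp (fun n => - (lambda / (N n)%:R)) _)
  (cvg_exp (fun n => x / (N n)%:R) _)).
- near=> n.
  have lN1 : 0 < 1 - lambda / (N n)%:R by rewrite subr_gt0; near: n.
  have /andP[lo hi] := ubnd n; set l := lambda / (N n)%:R in lN1 hi *.
  have u0 : 0 < u n by apply: lt_le_trans lN1 _; rewrite lerBlDr -lerBlDl.
  have lambdaE : lambda = l * (N n)%:R by rewrite /l divfK ?gt_eqF.
  apply/andP; split.
    rewrite [X in - (X / _)]lambdaE mulrAC -mulNr expRM_natr.
    rewrite lerXn2r ?nnegrE ?expR_ge0 ?(ltW u0)//.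
    apply: le_trans (_ : 1 - l <= _); last by rewrite lerBlDr -lerBlDl.
    rewrite expRN -[leRHS]invrK lef_pV2 ?posrE ?expR_gt0 ?invr_gt0//.
    apply: le_trans (expR_ge1Dx _).
    by rewrite [leRHS](_ : _ = (1 - l)^-1)//; field; rewrite gt_eqF.
  have -> : lambda / (1 + x / (N n)%:R) =
      lambda / ((N n)%:R * (1 + x / (N n)%:R)) * (N n)%:R.
    by rewrite invfM mulrA mulrAC divfK ?gt_eqF.
  rewrite -mulNr expRM_natr lerXn2r ?nnegrE ?expR_ge0 ?(ltW u0)//.
  apply: le_trans (expR_ge1Dx _); by rewrite lerBrDr -lerBrDl.
- by rewrite -[X in _ --> X]oppr0; apply: cvgN; exact: cvg_small.
- exact: cvg_small.
Unshelve. all: by end_near. Qed.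

End Limits.

(** * First order behaviour of the ball averages *)

Section BallAverage.
Variables (R : realType) (p : nat) (p_pr : prime p) (d : nat) (d_ge1 : (1 <= d)%N).
Variable mu : {measure set (padic_vec p_pr d) -> \bar R}.
Hypothesis mu_haar : normalized_haar mu.
Variables (c b : R).
Hypotheses (c_gt0 : 0 < c) (b_gt0 : 0 < b).

Local Notation vol := (pball_volume R p d).
Local Notation q := ((p%:R : R) `^ b).
Local Notation theta := ((p%:R ^+ d)^-1 : R).
Local Notation a := (@alpha R p d b).
Local Notation G := (@ball_exp R p p_pr d mu c b).
Local Notation h := (@sphere_exp R p c b).

Definition ball_average (k : int) : R := ball_exp mu c b k / vol k.

Local Notation V := ball_average.

Lemma theta_itv : 0 < theta < 1.
Proof.
have pd0 : 0 < p%:R ^+ d :> R by rewrite exprn_gt0 ?prime_natr_gt0.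
by rewrite invr_gt0 pd0 invf_lt1// exprn_egt1 ?prime_natr_gt1// -lt0n.
Qed.

Lemma ball_averageS k : V k = theta * V (k - 1) + (1 - theta) * h k.
Proof.
have pd0 : p%:R ^+ d != 0 :> R by rewrite expf_neq0 ?prime_natr_neq0.
have v0 : vol (k - 1) != 0 by rewrite gt_eqF ?pball_volume_gt0.
rewrite /ball_average (ball_expS mu_haar _ c_gt0) (pball_volumeS R p_pr d k).
by move: (G _) (h _) (vol _) v0 => g e v v0; field; rewrite pd0 v0.
Qed.

Lemma ball_average_ge0 k : 0 <= V k.
Proof.
rewrite divr_ge0 ?(ltW (pball_volume_gt0 _ _ _ _))//.
apply: Rintegral_ge0 => y _; exact: radial_exp_ge0.
Qed.

Lemma ball_average_le1 k : V k <= 1.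
Proof.
by rewrite ler_pdivrMr ?pball_volume_gt0// mul1r; exact: ball_exp_le.
Qed.

(** [alpha] is the average of [|y| ^ b] over the unit ball: it solves the
    recursion that relates a ball to the next smaller one. *)
Lemma alpha_fixpoint : 0 < a /\ a * (1 - theta / q) = 1 - theta.
Proof.
have pd0 : 0 < p%:R ^+ d :> R by rewrite exprn_gt0 ?prime_natr_gt0.
have q0 : 0 < q by rewrite (lt_trans _ (primeb_gt1 p_pr b_gt0)).
have /andP[th0 th1] := theta_itv.
have q1 := primeb_gt1 p_pr b_gt0.
have pd1 : 1 < p%:R ^+ d :> R by rewrite -invf_lt1.
have aE : a = (q * p%:R ^+ d - q) / (q * p%:R ^+ d - 1).
  rewrite /alpha powRD; last by rewrite prime_natr_neq0 ?implybT.
  rewrite powR_mulrn ?ler0n//; set P := p%:R ^+ d in pd0 pd1 *.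
  have : q * P - 1 != 0 by rewrite subr_eq0 gt_eqF// mulr_egt1.
  by move: (q) => s s0; field.
have den : 0 < q * p%:R ^+ d - 1 by rewrite subr_gt0 mulr_egt1.
split; first by rewrite aE divr_gt0// -[X in _ - X]mulr1 -mulrBr mulr_gt0// subr_gt0.
rewrite aE; move: (p%:R ^+ d) (q) pd0 q0 den => P s P0 s0 den.
by field; rewrite !gt_eqF.
Qed.

Lemma average_defectS k : 1 - V k = theta * (1 - V (k - 1)) + (1 - theta) * (1 - h k).
Proof. by rewrite ball_averageS; ring. Qed.

Lemma primeb_exprzB1 (k : int) : q ^ (k - 1) = q ^ k / q.
Proof.
have q0 : q != 0 by rewrite gt_eqF// (lt_trans _ (primeb_gt1 p_pr b_gt0)).
by rewrite expfzDr.
Qed.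

(** As [1 - expR (- u) <= u], the defect satisfies the recursion with a source at
    most [c * q ^ k], for which [c * alpha * q ^ k] is the exact solution. *)
Lemma average_defect_le (k : int) : 1 - V k <= c * a * q ^ k.
Proof.
have [a0 aE] := alpha_fixpoint; have /andP[th0 th1] := theta_itv.
rewrite -subr_le0.
apply: (@contraction_le0 _ theta 1 (fun k => 1 - V k - c * a * q ^ k)).
- by rewrite ltW.
- move=> l _; rewrite average_defectS primeb_exprzB1.
  have h1 : 1 - h l <= c * q ^ l by rewrite lerBlDr -lerBlDl expR_ge1Dx.
  rewrite -subr_ge0.
  rewrite [leRHS](_ : _ = (1 - theta) * (c * q ^ l - (1 - h l)) +
    c * q ^ l * (a * (1 - theta / q) - (1 - theta))); last by ring.
  by rewrite aE subrr mulr0 addr0 mulr_ge0 ?subr_ge0// ltW.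
- move=> l _; rewrite -addrA -opprD gerBl addr_ge0 ?ball_average_ge0//.
  by rewrite mulr_ge0 ?(ltW (primeb_exprz_gt0 _ _ _))// mulr_ge0 ?(ltW a0) ?(ltW c_gt0).
Qed.

(** The same comparison from below, with [1 - expR (- u) >= u / (1 + u)] and
    [u <= c * q ^ K] on the ball. *)
Lemma average_defect_ge (K : int) : c * a * q ^ K / (1 + c * q ^ K) <= 1 - V K.
Proof.
have [a0 aE] := alpha_fixpoint; have /andP[th0 th1] := theta_itv.
have qgt0 l : 0 < q ^ l by exact: primeb_exprz_gt0.
have cq l : 0 < c * q ^ l by rewrite mulr_gt0.
set B := 1 + c * q ^ K; have B0 : 0 < B by rewrite addr_gt0.
rewrite -subr_le0.
apply: (@contraction_le0 _ theta (c * a * q ^ K / B)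
  (fun k => c * a * q ^ k / B - (1 - V k))).
- by rewrite ltW.
- move=> l lK; rewrite average_defectS primeb_exprzB1.
  have h1 : c * q ^ l / B <= 1 - h l.
    apply: le_trans (_ : c * q ^ l / (1 + c * q ^ l) <= _).
      rewrite ler_pM2l// lef_pV2 ?posrE ?addr_gt0// lerD2l ler_pM2l//.
      by rewrite (ler_eXz2l (primeb_gt1 p_pr b_gt0)).
    have u1 : 0 < 1 + c * q ^ l by rewrite addr_gt0.
    rewrite lerBrDl -lerBrDr -[X in _ <= X - _](divff (lt0r_neq0 u1)) -mulrBl addrK mul1r.
    by rewrite /sphere_exp expRN lef_pV2 ?posrE ?expR_gt0// expR_ge1Dx.
  rewrite -subr_ge0.
  rewrite [leRHS](_ : _ = (1 - theta) * ((1 - h l) - c * q ^ l / B) -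
    c * q ^ l / B * (a * (1 - theta / q) - (1 - theta))); last by ring.
  by rewrite aE subrr mulr0 subr0 mulr_ge0 ?subr_ge0// ltW.
- move=> l lK; apply: le_trans (_ : c * a * q ^ l / B <= _).
    by rewrite gerBl subr_ge0 ball_average_le1.
  rewrite ler_pM2r ?invr_gt0// ler_pM2l ?mulr_gt0//.
  by rewrite (ler_eXz2l (primeb_gt1 p_pr b_gt0)).
Qed.

Lemma cvg_ball_average : V (- n%:Z) @[n --> \oo] --> (1 : R).
Proof.
have q1 := primeb_gt1 p_pr b_gt0; have q0 := lt_trans ltr01 q1.
apply: (@squeeze_cvgr _ _ _ _ (fun n : nat => 1 - c * a * q^-1 ^+ n) (fun=> 1)).
- apply: nearW => n; rewrite ball_average_le1 andbT lerBlDr -lerBlDl.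
  by rewrite exprVn -[q ^+ n]/(q ^ n%:Z) invr_expz; exact: average_defect_le.
- rewrite -[X in _ --> X]subr0; apply: cvgB; first exact: cvg_cst.
  rewrite -[X in _ --> X](mulr0 (c * a)); apply: cvgMr.
  by apply: cvg_expr; rewrite ger0_norm ?invr_ge0 ?(ltW q0)// invf_lt1.
- exact: cvg_cst.
Qed.

Lemma pball_volumeN k : vol (- k) = (vol k)^-1.
Proof. by rewrite /pball_volume -invr_expz exprVn. Qed.

(** Integrating the density over a sphere produces the increments of the sequence
    of ball averages. *)
Lemma ball_average_increment (r : int) :
  (G (- r) - h (1 - r) * vol (- r)) * (vol r - vol (r - 1)) =
  V (- r) - V (1 - r).
Proof.
have mE : 1 - r - 1 = - r by lia.
have pd0 : p%:R ^+ d != 0 :> R by rewrite expf_neq0 ?prime_natr_neq0.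
have v0 : vol (- r) != 0 by rewrite gt_eqF ?pball_volume_gt0.
have vr : vol r = (vol (- r))^-1 by rewrite pball_volumeN invrK.
have vr1 : vol (r - 1) = (p%:R ^+ d * vol (- r))^-1.
  have -> : r - 1 = - (1 - r) by lia.
  by rewrite (pball_volumeN (1 - r)) (pball_volumeS R p_pr d (1 - r)) mE.
rewrite (ball_averageS (1 - r)) mE /ball_average vr vr1.
by move: (G _) (h _) (vol _) v0 => g e v v0; field; rewrite pd0 v0.
Qed.

End BallAverage.

(** * The law of an increment *)

Section Process.
Variables (R : realType) (p : nat) (p_pr : prime p) (d : nat).

Local Notation Qp := (padic p_pr).
Local Notation Qpd := 'rV[padic p_pr]_d.
Local Notation pball := (@pball p p_pr d).
Local Notation psphere := (@psphere p p_pr d).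
Local Notation path := (skorohod_space R p_pr d).

Definition increment (s t : {nonneg R}) (w : path) : padic_vec p_pr d :=
  (w : skorohod R p_pr d) t - (w : skorohod R p_pr d) s.

Lemma measurable_evaluation (t : {nonneg R}) (A : set (padic_vec p_pr d)) :
  measurable A -> measurable [set w : path | A ((w : skorohod R p_pr d) t)].
Proof. by move=> mA; apply: sub_sigma_algebra; exists t, A. Qed.

Lemma pball_rat_dense (k : int) (x : Qpd) :
  exists v : 'rV[rat]_d, pball k (x - map_mx (padic_of_rat p_pr) v).
Proof.
have dense i := padic_rat_dense (x ord0 i) (prime_exprz_gt0 p_pr rat k).
exists (\row_i projT1 (cid (dense i))) => i; rewrite !mxE.
exact: ltW (projT2 (cid (dense i))).
Qed.

(** A ball around 0 is a subgroup with countably many cosets, each of which has a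
    rational representative. *)
Lemma pballB_coset (k : int) (x y : Qpd) : pball k (y - x) <->
  exists v : 'rV[rat]_d, pball k (x - map_mx (padic_of_rat p_pr) v) /\
                         pball k (y - map_mx (padic_of_rat p_pr) v).
Proof.
split=> [xy|[v [xv yv]]].
  have [v xv] := pball_rat_dense k x; exists v; split; first exact: xv.
  by have := pballD xy xv; rewrite addrA subrK.
by have := pballB yv xv; rewrite opprB addrA subrK.
Qed.

Lemma measurable_increment_pball (s t : {nonneg R}) (k : int) :
  measurable [set w : path | pball k (increment s t w)].
Proof.
pose coset (u : {nonneg R}) (v : 'rV[rat]_d) :=
  [set w : path | (translation (- map_mx (padic_of_rat p_pr) v) @^-1` pball k)
     ((w : skorohod R p_pr d) u)].
have -> : [set w : path | pball k (increment s t w)] =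
    \bigcup_v (coset s v `&` coset t v).
  apply/seteqP; split=> w.
    by move=> /pballB_coset[v [ws wt]]; exists v; [|split; [exact: ws|exact: wt]].
  by move=> [v _ [ws wt]]; apply/pballB_coset; exists v; split; [exact: ws|exact: wt].
apply: countable_bigcupT_measurable => [|v]; first exact: countableP.
have mpre : measurable (translation (- map_mx (padic_of_rat p_pr) v) @^-1` pball k).
  rewrite -[_ @^-1` _]setTI; apply: measurable_translation => //.
  exact: measurable_pball.
by apply: measurableI; exact: measurable_evaluation.
Qed.

End Process.

Section IncrementLaw.
Variables (R : realType) (p : nat) (p_pr : prime p) (d : nat) (d_ge1 : (1 <= d)%N).
Variables (sigma b : R) (sigma_gt0 : 0 < sigma) (b_gt0 : 0 < b).
Variable mu : {measure set (padic_vec p_pr d) -> \bar R}.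
Hypothesis mu_haar : normalized_haar mu.
Variable P : probability (skorohod_space R p_pr d) R.
Hypothesis P_law : maxnorm_law P mu sigma b.

Local Notation Qpd := 'rV[padic p_pr]_d.
Local Notation pball := (@pball p p_pr d).
Local Notation psphere := (@psphere p p_pr d).
Local Notation vol := (pball_volume R p d).
Local Notation path := (skorohod_space R p_pr d).

Variables (s t : {nonneg R}) (st : s%:num < t%:num).

Local Notation tau := (t%:num - s%:num).
Local Notation V := (ball_average mu (sigma * tau) b).

Let sigmatau_gt0 : 0 < sigma * tau.
Proof. by rewrite mulr_gt0// subr_gt0. Qed.

Definition increment_prob (k : int) : R :=
  fine (P [set w : path | pball k (increment s t w)]).

Lemma increment_probE k :
  P [set w : path | pball k (increment s t w)] = (increment_prob k)%:E.
Proof. by rewrite fineK// fin_num_measure//; exact: measurable_increment_pball. Qed.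

Lemma psphere_prob k :
  fine (P [set w : path | psphere k (increment s t w)]) = V (- k) - V (1 - k).
Proof.
have [_ _ /(_ s t st _ (@measurable_psphere p p_pr d k))] := P_law.
rewrite -(ball_average_increment d_ge1 mu_haar sigmatau_gt0 b_gt0 k).
move=> /(congr1 (@complex.Re R)) PE; rewrite [LHS]PE.
apply: (Rintegral_psphere_cst mu_haar) => x xk.
exact: density_psphere.
Qed.

Lemma increment_prob_diff k :
  increment_prob k - increment_prob (k - 1) = V (- k) - V (1 - k).
Proof.
rewrite -psphere_prob /increment_prob.
have mB l := @measurable_increment_pball R p p_pr d s t l.
have PB := measureDI P (mB k) (mB (k - 1)).
have sub : [set w : path | pball k (increment s t w)] `&`
    [set w : path | pball (k - 1) (increment s t w)] =
    [set w : path | pball (k - 1) (increment s t w)].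
  by apply: setIidr => w; apply: subset_pball; lia.
rewrite PB sub fineD ?addrK//; apply: fin_num_measure; last exact: mB.
by apply: measurableD; exact: mB.
Qed.

Lemma cvg_increment_prob : increment_prob n%:Z @[n --> \oo] --> (1 : R).
Proof.
pose B (n : nat) := [set w : path | pball n%:Z (increment s t w)].
have BT : \bigcup_n B n = setT.
  apply/seteqP; split=> // w _.
  have : setT (increment s t w) by [].
  by rewrite -(bigcup_pball p_pr d) => -[n _ wn]; exists n.
have mB n : measurable (B n) by exact: measurable_increment_pball.
have ndB : {homo B : m n / (m <= n)%N >-> (m <= n)%O}.
  by move=> m n mn; apply/subsetPset => w; apply: subset_pball; lia.
have : (P \o B) n @[n --> \oo] --> P setT.
  by rewrite -BT; apply: nondecreasing_cvg_mu => //; rewrite BT.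
by rewrite probability_setT => /fine_cvg.
Qed.

(** Both sides have the same increments in [k] and the same limit 1. *)
Lemma increment_prob_average k : increment_prob k = V (- k).
Proof.
pose E l := increment_prob l - V (- l).
have ES l : E l = E (l - 1).
  have := increment_prob_diff l; rewrite /E.
  have -> : - (l - 1) = 1 - l by lia.
  by move: (increment_prob _) (V _) (increment_prob _) (V _) => x y z w; lra.
have E0n (n : nat) : E n%:Z = E 0.
  elim: n => [//|n IHn]; rewrite ES -IHn; congr E; lia.
have E0 l : E l = E 0.
  case: l => n; first exact: E0n.
  rewrite NegzE; elim: n => [|n <-]; first by rewrite [RHS]ES; congr E; lia.
  by rewrite [RHS]ES; congr E; lia.
have cvgE : E n%:Z @[n --> \oo] --> (1 - 1 : R).
  apply: cvgB; first exact: cvg_increment_prob.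
  exact: (cvg_ball_average d_ge1 mu_haar sigmatau_gt0 b_gt0).
have E00 : E 0 = 0.
  have cvgE0 : E n%:Z @[n --> \oo] --> E 0.
    by rewrite (_ : (fun n : nat => E n%:Z) = cst (E 0)); [exact: cvg_cst|exact/funext].
  by rewrite subrr in cvgE; exact: (cvg_unique _ cvgE0 cvgE).
by apply/eqP; rewrite -subr_eq0 -/(E k) E0 E00.
Qed.

End IncrementLaw.

(** * Observation on dyadic grids *)

Section DyadicGrid.
Variables (R : realType) (p : nat) (p_pr : prime p) (d : nat).
Variables (T : R) (T_gt0 : 0 < T) (r : int).

Local Notation Qpd := 'rV[padic p_pr]_d.
Local Notation pball := (@pball p p_pr d).
Local Notation path := (skorohod_space R p_pr d).

Lemma grid_time_ge0 (n k : nat) : 0 <= k%:R * T / 2 ^+ n :> R.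
Proof. by rewrite divr_ge0 ?mulr_ge0 ?exprn_ge0 ?(ltW T_gt0). Qed.

Definition grid_time (n k : nat) : {nonneg R} := NngNum (grid_time_ge0 n k).

Definition stay_ball : set path :=
  [set w | forall t : {nonneg R}, t%:num <= T -> pball r ((w : skorohod R p_pr d) t)].

Definition stay_ball_grid (n : nat) : set path :=
  \bigcap_(k in `I_(2 ^ n).+1)
    [set w | pball r ((w : skorohod R p_pr d) (grid_time n k))].

Lemma sup_maxnorm_le (w : skorohod R p_pr d) :
  (ereal_sup [set (maxnorm R (w t))%:E | t in [set t : {nonneg R} | (t%:num <= T)%R]]
     <= (p%:R ^ r)%R%:E)%E <-> stay_ball w.
Proof.
split=> [sup_le t tT|ball_w].
  apply/(maxnorm_le R); rewrite -lee_fin; apply: le_trans sup_le.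
  by apply: ereal_sup_ubound; exists t.
by apply: ge_ereal_sup => _ [t tT <-]; rewrite lee_fin; apply/maxnorm_le; exact: ball_w.
Qed.

Lemma measurable_stay_ball_grid n : measurable (stay_ball_grid n).
Proof.
apply: fin_bigcap_measurable; first exact: finite_II.
by move=> k _; apply: measurable_evaluation; exact: measurable_pball.
Qed.

Lemma grid_timeS n k : grid_time n k = grid_time n.+1 (2 * k).
Proof.
have e2 : 2 ^+ n != 0 :> R by rewrite expf_neq0.
by apply/val_inj; rewrite /= exprS natrM; field.
Qed.

Lemma stay_ball_grid_decreasing :
  {homo stay_ball_grid : m n / (m <= n)%N >-> (n <= m)%O}.
Proof.
apply: homo_leq => [A|A B C BA AB|n]; [exact: lexx|exact: le_trans AB BA|].
apply/subsetPset => w wn k /= kn; rewrite grid_timeS; apply: wn => /=.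
by move: kn; rewrite !ltnS expnS leq_mul2l.
Qed.

Lemma right_limit_near (w : skorohod R p_pr d) (t : {nonneg R}) :
  exists2 e : R, 0 < e & forall s : {nonneg R},
    t%:num < s%:num -> s%:num < t%:num + e -> pball r (w s - w t).
Proof.
have [wt _] := skorohod_cadlag w t.
have : nbhs (w t : Qpd) [set x : Qpd | pball r (x - w t)].
  apply: open_nbhs_nbhs; split; last by rewrite /= subrr; exact: pball0.
  apply/padic_vec_openP => x xr; exists r => z zr.
  by rewrite /= addrAC; exact: pballD.
move=> /wt /nbhs_ballP[e /= e0 te]; exists e => // s ts ste.
have := te s%:num; rewrite /ball /= ltr_distlC => /(_ _ ts).
rewrite ste andbT (lt_trans _ ts) ?gtrBl// => /(_ isT).
rewrite /path_ext; congr (pball r (w _ - w t)); apply/val_inj => /=.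
by rewrite ger0_norm.
Qed.

(** Right continuity: each time before [T] is approached from the right by grid
    times. *)
Lemma bigcap_stay_ball_grid : \bigcap_n stay_ball_grid n = stay_ball.
Proof.
apply/seteqP; split=> [w wgrid t tT|w wball n _ k /= kn]; last first.
  apply: wball => /=; rewrite ler_pdivrMr ?exprn_gt0// mulrC ler_pM2l//.
  by rewrite -natrX ler_nat -ltnS.
have grid n k : (k <= 2 ^ n)%N -> pball r ((w : skorohod R p_pr d) (grid_time n k)).
  by move=> kn; exact: (wgrid n I k kn).
have [tTE|tT'] := eqVneq t%:num T.
  have -> : t = grid_time 0 1 by apply/val_inj; rewrite /= mul1r expr0 divr1.
  exact: grid.
have {tT'} tT' : t%:num < T by rewrite lt_neqAle tT' tT.
have [e e0 we] := right_limit_near w t.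
pose e' := Num.min e (T - t%:num).
have e'0 : 0 < e' by rewrite lt_min e0 subr_gt0.
have [n nE] : exists n : nat, T / 2 ^+ n < e'.
  exists (Num.bound (T / e')); rewrite ltr_pdivrMr ?exprn_gt0// mulrC -ltr_pdivrMr//.
  apply: lt_trans (archi_boundP _) _; first by rewrite divr_ge0 ?ltW.
  by rewrite -natrX ltr_nat ltn_expl.
(* [k + 1] is the index of the first grid time after [t]; the mesh is so fine that
   this time comes before [T] and before [t + e]. *)
have n0 : 0 < 2 ^+ n :> R by rewrite exprn_gt0.
have x0 : 0 <= t%:num * 2 ^+ n / T by rewrite divr_ge0 ?(ltW T_gt0)// mulr_ge0// ltW.
have /andP[le_k lt_k] := truncn_itv x0; set k := Num.trunc _ in le_k lt_k.
have kt : k%:R * T / 2 ^+ n <= t%:num.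
  by rewrite ler_pdivrMr// -ler_pdivlMr.
have tk : t%:num < k.+1%:R * T / 2 ^+ n.
  by rewrite ltr_pdivlMr// -ltr_pdivrMr.
have kS : k.+1%:R * T / 2 ^+ n = k%:R * T / 2 ^+ n + T / 2 ^+ n.
  by rewrite -natr1 !mulrDl mul1r.
have kte : k.+1%:R * T / 2 ^+ n < t%:num + e' by rewrite kS ler_ltD.
have kT : k.+1%:R * T / 2 ^+ n < T.
  by apply: lt_le_trans kte _; rewrite -lerBrDl ge_min lexx orbT.
have kn : (k.+1 <= 2 ^ n)%N.
  move: kT; rewrite ltr_pdivrMr// mulrC ltr_pM2l// -natrX ltr_nat; exact: ltnW.
have ws := grid _ _ kn.
have wst : pball r
    ((w : skorohod R p_pr d) (grid_time n k.+1) - (w : skorohod R p_pr d) t).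
  by apply: we => //=; apply: lt_le_trans kte _; rewrite lerD2l ge_min lexx.
by have := pballB ws wst; rewrite opprB addrC subrK.
Qed.

End DyadicGrid.

(** * The probability of staying in a ball *)

Section StayingProbability.
Variables (R : realType) (p : nat) (p_pr : prime p) (d : nat) (d_ge1 : (1 <= d)%N).
Variables (sigma b : R) (sigma_gt0 : 0 < sigma) (b_gt0 : 0 < b).
Variable mu : {measure set (padic_vec p_pr d) -> \bar R}.
Hypothesis mu_haar : normalized_haar mu.
Variable P : probability (skorohod_space R p_pr d) R.
Hypothesis P_law : maxnorm_law P mu sigma b.
Variables (T : R) (T_gt0 : 0 < T) (r : int).

Local Notation Qpd := 'rV[padic p_pr]_d.
Local Notation pball := (@pball p p_pr d).
Local Notation path := (skorohod_space R p_pr d).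
Local Notation q := ((p%:R : R) `^ b).
Local Notation a := (@alpha R p d b).

Definition grid_increments (n : nat) : set path :=
  \bigcap_(i : 'I_(2 ^ n)) [set w : path |
    pball r (increment (grid_time T_gt0 n i) (grid_time T_gt0 n i.+1) w)].

Lemma grid_step n k :
  (grid_time T_gt0 n k.+1)%:num - (grid_time T_gt0 n k)%:num = T / 2 ^+ n.
Proof. by rewrite /= -natr1 !mulrDl mul1r addrC addKr. Qed.

Lemma grid_time_lt n k : (grid_time T_gt0 n k)%:num < (grid_time T_gt0 n k.+1)%:num.
Proof. by rewrite -subr_gt0 grid_step divr_gt0// exprn_gt0. Qed.

Lemma trivIset_grid n : trivIset setT (fun i : 'I_(2 ^ n) =>
  [set` `](grid_time T_gt0 n i)%:num, (grid_time T_gt0 n i.+1)%:num]]).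
Proof.
have T2 : 0 < T / 2 ^+ n by rewrite divr_gt0// exprn_gt0.
have le_index (i j : nat) x : x <= (grid_time T_gt0 n i.+1)%:num ->
    (grid_time T_gt0 n j)%:num < x -> (j <= i)%N.
  move=> xi /lt_le_trans/(_ xi); rewrite /= -!mulrA ltr_pM2r// ltr_nat.
  by rewrite ltnS.
move=> i j _ _ [x [/=]]; rewrite !in_itv/= => /andP[ix xi] /andP[jx xj].
by apply/val_inj/eqP; rewrite eqn_leq (le_index _ _ x xi jx) (le_index _ _ x xj ix).
Qed.

(** The ball is a subgroup: starting at 0, the positions stay in it as long as
    the increments do. *)
Lemma stay_ball_grid_increments n :
  stay_ball_grid T_gt0 r n `&` [set w : path | (w : skorohod R p_pr d) 0%:nng = 0] =
  grid_increments n `&` [set w : path | (w : skorohod R p_pr d) 0%:nng = 0].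
Proof.
have grid0 : grid_time T_gt0 n 0 = 0%:nng by apply/val_inj; rewrite /= !mul0r.
apply/seteqP; split=> w [ww w0]; split=> //.
  move=> i _; have i2 := ltn_ord i.
  by apply: pballB; apply: ww => /=; rewrite ltnS// ltnW.
elim=> [|k IHk] /= kn.
  by rewrite grid0 w0; exact: pball0.
have {}IHk := IHk (ltnW kn); rewrite ltnS in kn.
by have := pballD (ww (Ordinal kn) I) IHk; rewrite /increment subrK.
Qed.

Lemma stay_ball_grid_prob n : P (stay_ball_grid T_gt0 r n) =
  (ball_average mu (sigma * (T / 2 ^+ n)) b (- r) ^+ (2 ^ n))%:E.
Proof.
have [P0 P_indep _] := P_law.
have m0 : measurable [set w : path | (w : skorohod R p_pr d) 0%:nng = 0].
  exact: (@measurable_evaluation R p p_pr d 0%:nng _ (@measurable_padic0 p p_pr d)).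
have mI : measurable (grid_increments n).
  apply: fin_bigcap_measurable; first exact: finite_finset.
  by move=> i _; exact: measurable_increment_pball.
rewrite -(probability_setI_full (measurable_stay_ball_grid _ _ _) m0 P0).
rewrite stay_ball_grid_increments probability_setI_full//.
have := P_indep _ _ _ (fun i => grid_time_lt n i) (@trivIset_grid n)
  (fun=> pball r) (fun=> @measurable_pball p p_pr d r).
move=> ->; under eq_bigr => i _.
  rewrite [P _](increment_probE P _ _ r).
  rewrite (increment_prob_average d_ge1 sigma_gt0 b_gt0 mu_haar P_law (grid_time_lt n i)).
  rewrite grid_step; over.
by rewrite prodEFin prodr_const card_ord.
Qed.

Lemma cvg_grid_prob :
  ball_average mu (sigma * (T / 2 ^+ n)) b (- r) ^+ (2 ^ n) @[n --> \oo] -->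
  expR (- (sigma * a * T * q ^ (- r))).
Proof.
have [a0 _] := alpha_fixpoint p_pr d_ge1 b_gt0.
have qr0 : 0 < q ^ (- r) by exact: primeb_exprz_gt0.
apply: (@cvg_power_expR _ _ (sigma * T * q ^ (- r))) => [||n||n].
- by rewrite !mulr_gt0.
- by rewrite !mulr_gt0.
- by rewrite expn_gt0.
- under eq_fun do rewrite natrX -exprVn.
  by apply: cvg_expr; rewrite ger0_norm ?invr_ge0// invf_lt1// ltr1n.
have N0 : 0 < 2 ^+ n :> R by rewrite exprn_gt0.
have c0 : 0 < sigma * (T / 2 ^+ n) by rewrite mulr_gt0// divr_gt0.
have lo := average_defect_ge d_ge1 mu_haar c0 b_gt0 (- r).
have hi := average_defect_le d_ge1 mu_haar c0 b_gt0 (- r).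
apply/andP; split.
  apply: le_trans lo; rewrite le_eqVlt natrX; apply/orP; left; apply/eqP.
  have den : 2 ^+ n + sigma * T * q ^ (- r) != 0 by rewrite gt_eqF// addr_gt0// !mulr_gt0.
  move: (2 ^+ n) (q ^ (- r)) N0 den => N Q N0 den.
  by field; rewrite den gt_eqF.
apply: le_trans hi _; rewrite natrX le_eqVlt; apply/orP; left; apply/eqP.
by rewrite -!mulrA; congr (_ * _); ring.
Qed.

Lemma stay_ball_prob : P (stay_ball T r) = (expR (- (sigma * a * T * q ^ (- r))))%:E.
Proof.
have mS := @measurable_stay_ball_grid R p p_pr d T T_gt0 r.
have PS : P (stay_ball_grid T_gt0 r n) @[n --> \oo] --> P (stay_ball T r).
  rewrite -(bigcap_stay_ball_grid p_pr d T_gt0); apply: nonincreasing_cvg_mu => //.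
  - exact: le_lt_trans (probability_le1 _ (mS _)) (ltry _).
  - exact: bigcapT_measurable.
  - exact: stay_ball_grid_decreasing.
have PV : P (stay_ball_grid T_gt0 r n) @[n --> \oo] -->
    (expR (- (sigma * a * T * q ^ (- r))))%:E.
  under eq_fun do rewrite stay_ball_grid_prob.
  by apply: cvg_EFin; [exact: nearW|exact: cvg_grid_prob].
exact: (cvg_unique _ PS PV).
Qed.

End StayingProbability.

Theorem theorem4p2 (R : realType) (p : nat) (p_pr : prime p) (d : nat)
    (d_ge1 : (1 <= d)%N) (sigma b : R) (sigma_gt0 : 0 < sigma) (b_gt0 : 0 < b)
    (mu : {measure set (padic_vec p_pr d) -> \bar R})
    (mu_haar : normalized_haar mu)
    (P : probability (skorohod_space R p_pr d) R)
    (P_law : maxnorm_law P mu sigma b)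
    (r : int) (T : R) (T_gt0 : 0 < T) :
  P [set X : skorohod R p_pr d |
      (ereal_sup [set (maxnorm R (X t))%:E |
                   t in [set t : {nonneg R} | (t%:num <= T)%R]]
       <= (p%:R ^ r)%R%:E)%E]
  = (expR (- (sigma * alpha p d b * T * p%:R `^ (- (r%:~R * b)))))%:E.
Proof.
have -> : p%:R `^ (- (r%:~R * b)) = (p%:R : R) `^ b ^ (- r).
  by rewrite -(powR_intmul _ (powR_ge0 p%:R b)) -powRrM intrN mulrN [b * _]mulrC.
rewrite -(stay_ball_prob d_ge1 sigma_gt0 b_gt0 mu_haar P_law T_gt0); congr (P _).
by apply/seteqP; split=> X /sup_maxnorm_le.
Qed.
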